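(* For every $\xi\in\mathcal{D}^o$, every $N,M,K\in\mathbb{N}$, every bounded $f:\Omega\times U^{\mathbb{N}}\to\mathbb{R}$ such that $f(\cdot,(z_i)_{i\ge1})$ does not depend on $(z_i)_{i>K}$ and is $\mathcal{B}_{-N}^+\cap\mathcal{B}_M^-$-measurable for each $(z_i)_{i\ge1}$, and every $\epsilon>0$, $$\limsup_{\delta\to0}\limsup_{n\to\infty}\frac1n\log P_{0,0}\left(\left|\int f\,\mathrm{d}\bar\nu_{n,X}^\infty-\int f\,\mathrm{d}\bar\mu_\xi^\infty\right|>\epsilon\ \middle|\ \left|\tfrac{X_n}{n}-\xi\right|\le\delta\right)<0.$$
   Context: Space-time RWRE on $\mathbb{Z}^d$: environment $\omega=(\omega_{n,x})_{n\in\mathbb{Z},x\in\mathbb{Z}^d}$, $\omega_{n,x}=(\pi_{n,n+1}(x,x+z))_{z\in U}$ probability vectors, $U:=\{z:|z_1|+\cdots+|z_d|=1\}$; the $\omega_{n,x}$ are i.i.d. under $\mathbb{P}$ and $\mathbb{P}(\pi_{0,1}(0,z)\ge c_1)=1$ for all $z\in U$, some $c_1>0$. $P_{k,x}^\omega$ is the quenched law of the walk with $X_k=x$ and $P(X_{n+1}=y+z\mid X_n=y)=\pi_{n,n+1}(y,y+z)$; $P_{k,x}:=\int P_{k,x}^\omega\,\mathrm{d}\mathbb{P}$, expectation $E_{k,x}$. $Z_i:=X_i-X_{i-1}$. Shifts $(T_{m,y}\omega)_{n,x}=\omega_{n+m,x+y}$. $\mathcal{B}_n^-$ (resp. $\mathcal{B}_n^+$)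 is the $\sigma$-algebra generated by $\omega_{m,x}$, $x\in\mathbb{Z}^d$, $m\le n$ (resp. $m\ge n$). $q(z):=\mathbb{E}[\pi_{0,1}(0,z)]$, $\Lambda_c(\theta):=\log\sum_{z\in U}q(z)\mathrm{e}^{\langle\theta,z\rangle}$. $\mathcal{D}:=\{\xi\in\mathbb{R}^d:|\xi_1|+\cdots+|\xi_d|\le1\}$, $\mathcal{D}^o$ its interior; for $\xi\in\mathcal{D}^o$ there is a unique $\theta$ with $\xi=\nabla\Lambda_c(\theta)$. $\bar\mu_\xi^\infty$ is the measure on $\Omega\times U^{\mathbb{N}}$ defined, for $N,M,K$ and $f$ as in the claim, by $\int f\,\mathrm{d}\bar\mu_\xi^\infty:=E_{0,0}[\mathrm{e}^{\langle\theta,X_{N+M+K+1}\rangle-(N+M+K+1)\Lambda_c(\theta)}f(T_{N,X_N}\omega,(Z_{N+i})_{i\ge1})]$. The empirical process is $\bar\nu_{n,X}^\infty:=\frac1n\sum_{j=0}^{n-1}\delta_{(T_{j,X_j}\omega,(Z_{j+i})_{i\ge1})}$. *)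

(* Defs.v *)
From HB Require Import structures.
From mathcomp Require Import all_boot all_order all_algebra.
From mathcomp Require Import all_classical all_reals all_analysis.
Set Implicit Arguments. Unset Strict Implicit. Unset Printing Implicit Defensive.
Import Order.TTheory GRing.Theory Num.Theory.
Local Open Scope classical_set_scope.
Local Open Scope ring_scope.

Section SpaceTimeRWRE.
Variables (R : realType) (d : nat).

(* Unit steps U = {z in Z^d : |z|_1 = 1}, encoded as (coordinate, sign). *)
Definition U : finType := ('I_d * bool)%type.

Definition site := 'I_d -> int.
Definition site0 : site := fun _ => 0%R.
Definition siteD (x y : site) : site := fun i => x i + y i.

Definition vecU (z : U) : site :=
  fun i => if i == z.1 then (if z.2 then 1%R else (-1)%R) else 0%R.

(* environment: w n x z = pi_{n,n+1}(x, x+z) *)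
Definition Env := int -> site -> U -> R.

Definition shift (m : int) (y : site) (w : Env) : Env :=
  fun n x => w (n + m)%R (siteD x y).

(* step sequences: z k = Z_{k+1};  X_k = Z_1 + ... + Z_k, X_0 = 0 *)
Definition pos (z : nat -> U) (k : nat) : site :=
  fun i => \sum_(j < k) vecU (z j) i.

Definition weight (w : Env) (z : nat -> U) (L : nat) : R :=
  \prod_(j < L) w (j%:Z) (pos z j) (z j).

Definition ext (L : nat) (u0 : U) (s : {ffun 'I_L -> U}) : nat -> U :=
  fun k => if insub k is Some i then s i else u0.

Variables (dT : measure_display) (T : measurableType dT) (P : probability T R).
Variable pi : int -> site -> U -> T -> R.

Definition omega (t : T) : Env := fun n x z => pi n x z t.

(* i.i.d. family of random vectors omega_{n,x} = (pi n x z)_{z in U}: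
   mutual independence and identical distribution, tested on the
   (generating, pi-stable) rectangles of R^U. *)
Definition iid_field : Prop :=
  (forall (k : nat) (idx : 'I_k -> (int * site)%type), injective idx ->
     forall B : 'I_k -> U -> set R, (forall i z, measurable (B i z)) ->
     P [set t | forall i z, B i z (pi (idx i).1 (idx i).2 z t)] =
     (\prod_(i < k) P [set t | forall z, B i z (pi (idx i).1 (idx i).2 z t)])%E)
  /\
  (forall n x m y (B : U -> set R), (forall z, measurable (B z)) ->
     P [set t | forall z, B z (pi n x z t)] = P [set t | forall z, B z (pi m y z t)]).

(* annealed law P_{0,0} of an event depending on the environment and on the
   first L steps of the walk (the value does not depend on u0 then) *)
Definition P00 (u0 : U) (L : nat) (A : Env -> (nat -> U) -> Prop) : R :=
  fine (\sum_(s : {ffun 'I_L -> U})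
          \int[P]_(t in [set t | A (omega t) (ext u0 s)])
              (weight (omega t) (ext u0 s) L)%:E)%E.

Definition E00 (u0 : U) (L : nat) (g : Env -> (nat -> U) -> R) : R :=
  fine (\sum_(s : {ffun 'I_L -> U})
          \int[P]_t (weight (omega t) (ext u0 s) L * g (omega t) (ext u0 s))%:E)%E.

Definition P00cond (u0 : U) (L : nat) (A B : Env -> (nat -> U) -> Prop) : R :=
  P00 u0 L (fun w z => A w z /\ B w z) / P00 u0 L B.

Definition q (z : U) : R := fine (\int[P]_t (pi 0 site0 z t)%:E).

Definition dotU (theta : 'I_d -> R) (z : U) : R :=
  \sum_i theta i * (vecU z i)%:~R.

Definition Lambda_c (theta : 'I_d -> R) : R :=
  ln (\sum_(z : U) q z * expR (dotU theta z)).

Definition grad_Lambda_c_eq (theta xi : 'I_d -> R) : Prop :=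
  forall i : 'I_d,
    is_derive (0 : R) (1 : R)
      (fun h : R => Lambda_c (fun j => theta j + (if j == i then h else 0)))
      (xi i).

End SpaceTimeRWRE.

Definition coord_sys (R : realType) (d : nat) (Pt : int -> Prop) : set_system (Env R d) :=
  [set A | exists n x z (B : set R),
     Pt n /\ measurable B /\ A = (fun w : Env R d => w n x z) @^-1` B].

Definition Bplus (R : realType) (d : nat) (n : int) : set_system (Env R d) :=
  <<s @coord_sys R d (fun m => (n <= m)%R) >>.
Definition Bminus (R : realType) (d : nat) (n : int) : set_system (Env R d) :=
  <<s @coord_sys R d (fun m => (m <= n)%R) >>.

Definition meas_wrt (R : realType) (d : nat) (S : set_system (Env R d))
  (g : Env R d -> R) : Prop :=
  forall B : set R, measurable B -> S (g @^-1` B).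

Definition euclid (R : realType) (d : nat) (v : 'I_d -> R) : R :=
  Num.sqrt (\sum_i v i ^+ 2).

Definition nu_int (R : realType) (d : nat) (f : Env R d -> (nat -> U d) -> R)
  (n : nat) (w : Env R d) (z : nat -> U d) : R :=
  n%:R^-1 * \sum_(j < n) f (shift j%:Z (pos z j) w) (fun k => z (j + k)%N).

Definition mu_int (R : realType) (d : nat) (dT : measure_display) (T : measurableType dT)
  (P : probability T R) (pi : int -> site d -> U d -> T -> R) (u0 : U d)
  (theta : 'I_d -> R) (N M K : nat) (f : Env R d -> (nat -> U d) -> R) : R :=
  let L := (N + M + K).+1 in
  E00 P pi u0 L (fun w z =>
     expR (\sum_i theta i * (pos z L i)%:~R - L%:R * Lambda_c P pi theta)
     * f (shift N%:Z (pos z N) w) (fun k => z (N + k)%N)).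

Definition elog (R : realType) (p : R) : \bar R :=
  if (0 < p)%R then (ln p)%:E else -oo%E.

Definition u0 (d : nat) (hd : (0 < d)%N) : U d := (Ordinal hd, true).

(* Main.v *)
Require Import Defs.
From HB Require Import structures.
From mathcomp Require Import all_boot all_order all_algebra.
From mathcomp Require Import all_classical all_reals all_analysis.
From mathcomp Require Import measurable_realfun.
From mathcomp Require Import ring lra zify.
Import Order.TTheory GRing.Theory Num.Theory.
Import numFieldTopology.Exports.
Local Open Scope classical_set_scope.
Local Open Scope ring_scope.

(* Let theta be dual to xi and weight the walk with exp(<theta, X_n> - n Lambda_c(theta)).
   At every step the walk reads a time level of the environment that is independent of the
   past, so under the tilted annealed measure the local function f seen from the walk at time
   j depends only on the j-th and neighbouring terms of an i.i.d. sequence. Summands at times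
   congruent modulo L = N + M + K + 1 are therefore i.i.d. with mean the integral of f against
   mu_xi, and a Chernoff bound on each residue class makes the deviation event exponentially
   unlikely at a rate c that does not involve delta. Undoing the tilt on {|X_n/n - xi| <= delta}
   costs a factor exp(|theta|_1 delta n) in the numerator and in the denominator, the latter
   having tilted probability close to 1 because the tilted steps have mean grad Lambda_c = xi;
   for delta small this cannot compensate exp(- c n). *)

(** * The space-time environment *)

Section Environment.
Set Implicit Arguments.
Unset Strict Implicit.
Variables (R : realType) (d : nat).

Notation Eenv Pt := (g_sigma_algebraType (@coord_sys R d Pt)).

(** The obstacle is that [f] is read at random positions while, for a fixed environment, the steps
    are not independent. Both difficulties disappear once a finite word of steps is fixed. Every
    expectation is a finite sum over words of integrals over the environment, so the position
    reached at time a is a deterministic spatial shift, and the factors before and after time a read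
    disjoint time levels. By stationarity the integral of their product no longer involves that
    position, so the sum over words factorizes too. This is the renewal identity [TE_block]; the
    mass one of the tilted measure, the i.i.d. structure along a residue class and the law of large
    numbers all follow from it. It holds only after averaging over the environment, since
    exp(Lambda_c) normalizes the averaged step law [q] and not a quenched one. Because [f] looks N
    levels back and K steps ahead, events up to time n need a longer horizon; the surplus is bounded
    in n and costs only constants. *)

Lemma measurable_fun_env (Pt : int -> Prop) dS (S : measurableType dS)
    (phi : S -> Env R d) :
  (forall n x z, Pt n -> measurable_fun setT (fun s => phi s n x z)) ->
  measurable_fun setT (phi : S -> Eenv Pt).
Proof.
move=> h; apply: (@measurability _ _ S (Eenv Pt) setT phi (coord_sys Pt)) => //.
move=> _ [_ [n [x [z [B [hn [mB ->]]]]]] <-].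
exact: (h n x z hn measurableT B mB).
Qed.

Lemma measurable_coord (Pt : int -> Prop) n x z : Pt n ->
  measurable_fun setT (fun w : Eenv Pt => w n x z).
Proof.
move=> hn _ B mB; rewrite setTI; apply: sub_sigma_algebra.
by exists n, x, z, B.
Qed.

(** Every site carries a condition, [setT] off a finite list; keeping [B] total makes intersection
    pointwise, with no merging of lists. *)
Definition cyl (B : int * site d -> U d -> set R) : set (Env R d) :=
  [set w | forall p z, B p z (w p.1 p.2 z)].

Definition cylinders (Pt : int -> Prop) : set_system (Env R d) :=
  [set A | exists s B,
     [/\ uniq s, (forall p, p \in s -> Pt p.1), (forall p z, measurable (B p z)),
         (forall p, p \notin s -> B p = fun=> setT) & A = cyl B]].

Lemma cylI B B' : cyl B `&` cyl B' = cyl (fun p z => B p z `&` B' p z).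
Proof.
apply/seteqP; split => [w [h h'] p z|w h]; first by split; [exact: h|exact: h'].
by split=> p z; have [] := h p z.
Qed.

Lemma setI_closed_cylinders Pt : setI_closed (cylinders Pt).
Proof.
move=> _ _ [s [B [us sP mB Bs ->]]] [s' [B' [us' sP' mB' Bs' ->]]].
exists (undup (s ++ s')), (fun p z => B p z `&` B' p z); split.
- exact: undup_uniq.
- by move=> p; rewrite mem_undup mem_cat => /orP[/sP|/sP'].
- by move=> p z; exact: measurableI.
- move=> p; rewrite mem_undup mem_cat negb_or => /andP[/Bs -> /Bs' ->].
  by apply/funext => z; rewrite setIT.
- by rewrite cylI.
Qed.

Lemma cylindersT Pt : cylinders Pt setT.
Proof.
exists [::], (fun _ _ => setT); split => //.
by apply/seteqP; split.
Qed.

(** Single coordinates generate but are not stable under intersection; uniqueness of measures needs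
    a generating pi-system. *)
Lemma sigma_cylinders (Pt : int -> Prop) :
  (measurable : set_system (Eenv Pt)) = <<s cylinders Pt >>.
Proof.
apply/seteqP; split.
  apply: smallest_sub; first exact: smallest_sigma_algebra.
  move=> _ [n [x [z [B [hn [mB ->]]]]]]; apply: sub_sigma_algebra.
  exists [:: (n, x)],
    (fun p z' => if (p == (n, x)) && (z' == z) then B else setT); split => //.
  - by move=> p; rewrite inE => /eqP ->.
  - by move=> p z'; case: ifP.
  - by move=> p; rewrite inE => /negbTE ->.
  - apply/seteqP; split => [w /= Bw [m y] z'|w /(_ (n, x) z)] /=.
      by case: ifP => // /andP[/eqP[-> ->] /eqP ->].
    by rewrite !eqxx.
apply: smallest_sub; first exact: sigma_algebra_measurable.
move=> _ [s [B [us sP mB Bs ->]]].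
have -> : cyl B = \big[setI/setT]_(p <- s) \big[setI/setT]_z
    ((fun w : Env R d => w p.1 p.2 z) @^-1` B p z).
  rewrite -bigcap_seq; apply/seteqP; split => [w h p ps|w h p z].
    by rewrite -bigcap_seq => z _ /=; exact: h.
  have [ps|/Bs -> //] := boolP (p \in s).
  have := h p ps; rewrite -bigcap_seq => /(_ z) /=.
  by rewrite mem_index_enum; exact.
rewrite big_seq; apply: bigsetI_measurable => p ps.
apply: bigsetI_measurable => z _.
by have := @measurable_coord Pt p.1 p.2 z (sP _ ps) measurableT _ (mB p z); rewrite setTI.
Qed.

End Environment.

(** * Independence of the past levels and the shifted future *)

Section Independence.
Set Implicit Arguments.
Notation shift := Defs.shift.
Unset Strict Implicit.
Variables (R : realType) (d : nat).
Notation Eenv Pt := (g_sigma_algebraType (@coord_sys R d Pt)).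

Variables (dT : measure_display) (T : measurableType dT) (P : probability T R).
Variable pi : int -> site d -> U d -> T -> R.
Hypothesis Hmeas : forall n x z, measurable_fun setT (pi n x z).
Hypothesis Hiid : iid_field P pi.

Lemma measurable_omega Pt : measurable_fun setT (omega pi : T -> Eenv Pt).
Proof. by apply: measurable_fun_env => n x z _; exact: Hmeas. Qed.

Lemma measurable_shift (Pt Pt' : int -> Prop) (a : int) (y : site d) :
  (forall n, Pt n -> Pt' (n + a)) ->
  measurable_fun setT (shift a y : Eenv Pt' -> Eenv Pt).
Proof.
move=> h; apply: measurable_fun_env => n x z hn.
by apply: measurable_coord; exact: h.
Qed.

Lemma measurable_shift_omega Pt (a : int) (y : site d) :
  measurable_fun setT ((fun t => shift a y (omega pi t)) : T -> Eenv Pt).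
Proof. by apply: measurable_fun_env => n x z _; exact: Hmeas. Qed.

Let rho (b : U d -> set R) : \bar R :=
  P [set t | forall z, b z (pi 0 (@site0 d) z t)].

Lemma prob_cyl s B : uniq s -> (forall p z, measurable (B p z)) ->
  (forall p, p \notin s -> B p = fun=> setT) ->
  P (omega pi @^-1` cyl B) = (\prod_(p <- s) rho (B p))%E.
Proof.
move=> us mB Bs.
pose idx (i : 'I_(size s)) := tnth (in_tuple s) i.
have idxI : injective idx.
  by apply/tuple_uniqP.
have -> : omega pi @^-1` cyl B =
    [set t | forall i z, B (idx i) z (pi (idx i).1 (idx i).2 z t)].
  apply/seteqP; split => t /= h => [i z|p z]; first exact: h.
  have [/tnthP[i ->]|/Bs -> //] := boolP (p \in in_tuple s).
  exact: h.
rewrite (Hiid.1 _ idx idxI (fun i => B (idx i))); last by move=> i z; exact: mB.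
rewrite [RHS]big_tnth; apply: eq_bigr => i _.
exact: Hiid.2.
Qed.

(** The shift moves the sites of [B] to levels at least [a], hence off the sites of [A], whatever
    the spatial displacement [y]. [prob_cyl] then gives a product over all sites, in which the
    displacement is invisible because all sites share one law. *)
Lemma indep_shift_cyl (a : int) (y : site d) A B :
  cylinders (fun n => (n < a)%R) A -> cylinders (fun n => (0 <= n)%R) B ->
  P (omega pi @^-1` A `&` (fun t => shift a y (omega pi t)) @^-1` B) =
  (P (omega pi @^-1` A) * P (omega pi @^-1` B))%E.
Proof.
move=> [s1 [B1 [us1 sP1 mB1 Bs1 ->]]] [s2 [B2 [us2 sP2 mB2 Bs2 ->]]].
pose sh (p : int * site d) := (p.1 + a, siteD p.2 y).
pose hs (p : int * site d) : int * site d := (p.1 - a, fun i => p.2 i - y i).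
have shK : cancel sh hs.
  move=> [n x]; rewrite /sh /hs /= addrK; congr pair; apply/funext => i.
  by rewrite /siteD addrK.
have hsK : cancel hs sh.
  move=> [n x]; rewrite /sh /hs /= subrK; congr pair; apply/funext => i.
  by rewrite /siteD subrK.
have ush : uniq [seq sh p | p <- s2].
  by rewrite map_inj_uniq//; exact: can_inj shK.
have E : (fun t => shift a y (omega pi t)) @^-1` cyl B2 =
    omega pi @^-1` cyl (fun p => B2 (hs p)).
  apply/seteqP; split => t /= h p z.
    have : B2 (hs p) z (omega pi t (sh (hs p)).1 (sh (hs p)).2 z) := h (hs p) z.
    by rewrite hsK.
  by have := h (sh p) z; rewrite shK.
have Bs2' p : p \notin [seq sh q | q <- s2] -> B2 (hs p) = fun=> setT.
  move=> ps; apply: Bs2; apply: contra ps => ps.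
  by apply/mapP; exists (hs p) => //; rewrite hsK.
have disj p : p \in s1 -> p \notin [seq sh q | q <- s2].
  move=> ps; apply/negP => /mapP[q qs pq].
  have := sP1 _ ps; rewrite pq /= ltNge.
  by rewrite lerDr (sP2 _ qs).
rewrite E -preimage_setI cylI (@prob_cyl (s1 ++ [seq sh q | q <- s2])).
- rewrite big_cat /= (@prob_cyl s1)// (@prob_cyl s2)//; congr (_ * _)%E.
    apply: eq_big_seq => p ps; congr rho.
    by apply/funext => z; rewrite Bs2' ?setIT//; exact: disj.
  rewrite big_map; apply: eq_big_seq => p ps; congr rho.
  rewrite shK; apply/funext => z; rewrite Bs1 ?setTI//.
  by apply/negP => /disj; rewrite map_f.
- rewrite cat_uniq us1 ush andbT /=.
  by apply/hasPn => p ps; apply/negP => /disj; rewrite ps.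
- by move=> p z; exact: measurableI.
- move=> p; rewrite mem_cat negb_or => /andP[/Bs1 -> /Bs2' ->].
  by apply/funext => z; rewrite setIT.
Qed.

(** Both sides are finite measures in [B] that agree on a pi-system. The second map [psi] is there
    because the product is wanted with the law of the unshifted environment. *)
Lemma indep_extend dE (E : measurableType dE) (G : set_system E) (D : set T)
    (phi psi : T -> E) :
  measurable D -> measurable_fun setT phi -> measurable_fun setT psi ->
  (measurable : set_system E) = <<s G >> -> setI_closed G -> G setT ->
  (forall B, G B -> P (D `&` phi @^-1` B) = (P D * P (psi @^-1` B))%E) ->
  forall B, measurable B -> P (D `&` phi @^-1` B) = (P D * P (psi @^-1` B))%E.
Proof.
move=> mD mphi mpsi mG GI GT GE B mB.
have PDfin : P D \is a fin_num by exact: fin_num_measure.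
have PD0 : 0 <= fine (P D) by exact: fine_ge0.
pose psim : {mfun T >-> E} := HB.pack psi (isMeasurableFun.Build _ _ _ _ _ mpsi).
pose m1 := measure_function_pushforward__canonical__measure_function_Measure (mrestr P mD) mphi.
pose m2 := mscale (NngNum PD0) (distribution P psim).
have m1E X : m1 X = P (D `&` phi @^-1` X) by rewrite setIC.
have m2E X : m2 X = (P D * P (psi @^-1` X))%E by rewrite /m2 /mscale /= fineK.
rewrite -m1E -m2E.
apply: (measure_unique G (fun=> setT) mG GI _ _ m1 m2) => //.
- by rewrite bigcup_const.
- by move=> A GA; have := GE A GA; rewrite -m1E -m2E.
- move=> _; rewrite /= m1E preimage_setT setIT.
  by rewrite ltey_eq PDfin.
Qed.

(** The pi-system argument is run one factor at a time: [B] is freed while [A] is a cylinder, then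
    [A] is freed with [B] fixed. *)
Lemma indep_shift (a : int) (y : site d) A B :
  measurable (A : set (Eenv (fun n => (n < a)%R))) ->
  measurable (B : set (Eenv (fun n => (0 <= n)%R))) ->
  P (omega pi @^-1` A `&` (fun t => shift a y (omega pi t)) @^-1` B) =
  (P (omega pi @^-1` A) * P (omega pi @^-1` B))%E.
Proof.
move=> mA mB.
pose D := (fun t => shift a y (omega pi t)) @^-1` B.
have shE X : measurable (X : set (Eenv (fun n => (0 <= n)%R))) ->
    forall A, cylinders (fun n => (n < a)%R) A ->
    P (omega pi @^-1` A `&` (fun t => shift a y (omega pi t)) @^-1` X) =
    (P (omega pi @^-1` A) * P (omega pi @^-1` X))%E.
  move=> mX A' cA'.
  apply: (@indep_extend _ (Eenv (fun n => (0 <= n)%R)) (cylinders (fun n => (0 <= n)%R))) => //.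
  - rewrite -[X in measurable X]setTI.
    apply: (@measurable_omega (fun n => (n < a)%R)) => //.
    rewrite sigma_cylinders; exact: sub_sigma_algebra.
  - exact: measurable_shift_omega.
  - exact: measurable_omega.
  - exact: sigma_cylinders.
  - exact: setI_closed_cylinders.
  - exact: cylindersT.
  - by move=> B'; exact: indep_shift_cyl.
have mD : measurable D.
  rewrite -[D]setTI.
  exact: (@measurable_shift_omega (fun n => (0 <= n)%R)).
(* Taking [A] to be the whole space yields the invariance of the law under the shift. *)
have PD : P D = P (omega pi @^-1` B).
  have := shE _ mB _ (cylindersT _ _ _); rewrite preimage_setT setTI.
  by rewrite probability_setT mul1e.
rewrite -PD setIC muleC.
apply: (@indep_extend _ (Eenv (fun n => (n < a)%R)) (cylinders (fun n => (n < a)%R))) => //.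
- exact: measurable_omega.
- exact: measurable_omega.
- exact: sigma_cylinders.
- exact: setI_closed_cylinders.
- exact: cylindersT.
- by move=> A' cA'; rewrite PD setIC muleC shE.
Qed.

End Independence.

(** * Expectations of bounded measurable functions *)

Section Expectation.
Set Implicit Arguments.
Unset Strict Implicit.
Notation shift := Defs.shift.
Variables (R : realType) (dT : measure_display) (T : measurableType dT).
Variable P : probability T R.

Definition bmeas (h : T -> R) :=
  measurable_fun setT h /\ exists C, forall t, `|h t| <= C.

Lemma bmeas_cst c : bmeas (fun=> c).
Proof. by split; [exact: measurable_cst|exists `|c|]. Qed.

Lemma bmeasD h k : bmeas h -> bmeas k -> bmeas (fun t => h t + k t).
Proof.
move=> [mh [C hC]] [mk [D kD]]; split; first exact: measurable_funD.
by exists (C + D) => t; rewrite (le_trans (ler_normD _ _))// lerD.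
Qed.

Lemma bmeasM h k : bmeas h -> bmeas k -> bmeas (fun t => h t * k t).
Proof.
move=> [mh [C hC]] [mk [D kD]]; split; first exact: measurable_funM.
by exists (C * D) => t; rewrite normrM ler_pM.
Qed.

Lemma bmeas_sum (I : Type) (s : seq I) (h : I -> T -> R) :
  (forall i, bmeas (h i)) -> bmeas (fun t => \sum_(i <- s) h i t).
Proof.
move=> bh; elim: s => [|i s IH].
  by under eq_fun do rewrite big_nil; exact: bmeas_cst.
by under eq_fun do rewrite big_cons; exact: bmeasD.
Qed.

Lemma bmeas_prod (I : Type) (s : seq I) (h : I -> T -> R) :
  (forall i, bmeas (h i)) -> bmeas (fun t => \prod_(i <- s) h i t).
Proof.
move=> bh; elim: s => [|i s IH].
  by under eq_fun do rewrite big_nil; exact: bmeas_cst.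
by under eq_fun do rewrite big_cons; exact: bmeasM.
Qed.

Lemma bmeas_expR h : bmeas h -> bmeas (fun t => expR (h t)).
Proof.
move=> [mh [C hC]]; split; first exact: measurableT_comp.
exists (expR C) => t; rewrite ger0_norm ?expR_ge0// ler_expR.
exact: le_trans (ler_norm _) (hC t).
Qed.

Lemma bmeas_bool (b : T -> bool) :
  measurable_fun setT b -> bmeas (fun t => (b t)%:R).
Proof.
move=> mb; split; last first.
  by exists 1 => t; case: (b t); rewrite ?normr0 ?normr1.
by apply: (@measurableT_comp _ _ _ _ _ _ (fun c : bool => (c%:R : R))).
Qed.

Lemma bmeas_integrable h : bmeas h -> P.-integrable setT (EFin \o h).
Proof.
move=> [mh [C hC]]; apply: measurable_bounded_integrable => //.
  by rewrite ltey_eq fin_num_measure.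
exists C; split; first exact: num_real.
by move=> x Cx t _ /=; apply: le_trans (hC t) (ltW Cx).
Qed.

Definition Ex (h : T -> R) : R := Rintegral P setT h.

Lemma eq_Ex h k : h =1 k -> Ex h = Ex k.
Proof. by move=> hk; congr Ex; apply/funext. Qed.

Lemma Ex_cst c : Ex (fun=> c) = c.
Proof. 
rewrite /Ex Rintegral_cst//; have /= -> := congr1 fine (probability_setT P).
by rewrite mulr1.
 Qed.

Lemma ExD h k : bmeas h -> bmeas k -> Ex (fun t => h t + k t) = Ex h + Ex k.
Proof. by move=> bh bk; apply: RintegralD => //; exact: bmeas_integrable. Qed.

Lemma ExZ c h : bmeas h -> Ex (fun t => c * h t) = c * Ex h.
Proof. by move=> bh; apply: RintegralZl => //; exact: bmeas_integrable. Qed.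

Lemma Ex_sum (I : Type) (s : seq I) (h : I -> T -> R) :
  (forall i, bmeas (h i)) ->
  Ex (fun t => \sum_(i <- s) h i t) = \sum_(i <- s) Ex (h i).
Proof.
move=> bh; elim: s => [|i s IH].
  by rewrite big_nil -[RHS]Ex_cst; apply: eq_Ex => t; rewrite big_nil.
rewrite big_cons -IH -ExD//; last exact: bmeas_sum.
by apply: eq_Ex => t; rewrite big_cons.
Qed.

Lemma le_Ex h k : bmeas h -> bmeas k -> (forall t, h t <= k t) -> Ex h <= Ex k.
Proof. by move=> bh bk hk; apply: le_Rintegral => //; exact: bmeas_integrable. Qed.

Lemma EFin_Ex h : bmeas h -> (Ex h)%:E = (\int[P]_t (h t)%:E)%E.
Proof.
move=> bh; rewrite /Ex /Rintegral fineK//.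
exact: integrable_fin_num (bmeas_integrable bh).
Qed.

End Expectation.

(** * Product formula for functions of past and future *)

Section Factorization.
Set Implicit Arguments.
Unset Strict Implicit.
Notation shift := Defs.shift.
Variables (R : realType) (d : nat).
Notation Eenv Pt := (g_sigma_algebraType (@coord_sys R d Pt)).

Variables (dT : measure_display) (T : measurableType dT) (P : probability T R).
Variable pi : int -> site d -> U d -> T -> R.
Hypothesis Hmeas : forall n x z, measurable_fun setT (pi n x z).
Hypothesis Hiid : iid_field P pi.

(** By [indep_shift] the joint law of past and shifted future agrees with the product law on
    rectangles, hence everywhere; Tonelli then splits the integral. *)
Lemma Ex_factor (a : int) (y : site d) (g1 g2 : Env R d -> R) :
  measurable_fun setT (g1 : Eenv (fun n => (n < a)%R) -> R) ->
  measurable_fun setT (g2 : Eenv (fun n => (0 <= n)%R) -> R) ->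
  bmeas (fun t => g1 (omega pi t)) -> bmeas (fun t => g2 (omega pi t)) ->
  bmeas (fun t => g2 (shift a y (omega pi t))) ->
  (forall t, 0 <= g1 (omega pi t)) -> (forall t, 0 <= g2 (omega pi t)) ->
  (forall t, 0 <= g2 (shift a y (omega pi t))) ->
  Ex P (fun t => g1 (omega pi t) * g2 (shift a y (omega pi t))) =
  Ex P (fun t => g1 (omega pi t)) * Ex P (fun t => g2 (omega pi t)).
Proof.
move=> mg1 mg2 b1 b2 b2' p1 p2 p2'.
pose E1 := Eenv (fun n => (n < a)%R); pose E2 := Eenv (fun n => (0 <= n)%R).
pose om1 : T -> E1 := omega pi.
pose om2 : T -> E2 := omega pi.
pose om2s : T -> E2 := fun t => shift a y (omega pi t).
have mom1 : measurable_fun setT om1 by exact: measurable_omega.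
have mom2 : measurable_fun setT om2 by exact: measurable_omega.
have mom2s : measurable_fun setT om2s by exact: measurable_shift_omega.
have mphi : measurable_fun setT (fun t => (om1 t, om2s t)) by exact: measurable_fun_pair.
pose X1 : {mfun T >-> E1} := HB.pack om1 (isMeasurableFun.Build _ _ _ _ _ mom1).
pose X2 : {mfun T >-> E2} := HB.pack om2 (isMeasurableFun.Build _ _ _ _ _ mom2).
pose X : {mfun T >-> (E1 * E2)%type} :=
  HB.pack (fun t => (om1 t, om2s t)) (isMeasurableFun.Build _ _ _ _ _ mphi).
(* Signs are known only along [omega pi t], whereas Tonelli integrates over all of [Env], which
   contains environments with negative entries; hence the absolute values. *)
pose h1 (w : E1) : \bar R := `|g1 w|%:E.
pose h2 (w : E2) : \bar R := `|g2 w|%:E.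
have mh1 : measurable_fun setT h1.
  by apply/measurable_EFinP; apply: measurableT_comp => //; exact: mg1.
have mh2 : measurable_fun setT h2.
  by apply/measurable_EFinP; apply: measurableT_comp => //; exact: mg2.
pose h (p : E1 * E2) := (h1 p.1 * h2 p.2)%E.
have mh : measurable_fun setT h.
  apply: emeasurable_funM; apply: measurableT_comp => //.
have h0 p : (0 <= h p)%E by rewrite mule_ge0 ?lee_fin.
have lawE A : measurable A ->
    (distribution P X1 \x distribution P X2)%E A = distribution P X A.
  apply: product_measure_unique => A' B' mA' mB'.
  exact: (indep_shift Hmeas Hiid y mA' mB').
have E12 : (\int[P]_t (h (X t)) =
    (\int[P]_t h1 (X1 t)) * (\int[P]_t h2 (X2 t)))%E.
  transitivity (\int[distribution P X]_p h p)%E.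
    exact/esym/(@ge0_integral_distribution _ _ _ _ _ P X h mh h0).
  transitivity (\int[(distribution P X1 \x distribution P X2)%E]_p h p)%E.
    by apply: eq_measure_integral => A mA _; exact/esym/lawE.
  rewrite fubini_tonelli1//.
  have i2 := @ge0_integral_distribution _ _ _ _ _ P X2 h2 mh2 (fun=> normr_ge0 _).
  have i1 := @ge0_integral_distribution _ _ _ _ _ P X1 h1 mh1 (fun=> normr_ge0 _).
  rewrite -[X in (X * _)%E]i1 -[X in (_ * X)%E]i2.
  set I2 := (\int[distribution P X2]_y h2 y)%E.
  transitivity (\int[distribution P X1]_x (h1 x * I2))%E.
    apply: eq_integral => x _; rewrite /fubini_F /h /=.
    rewrite ge0_integralZl//=; first by move=> z _; rewrite lee_fin.
    by rewrite lee_fin.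
  rewrite ge0_integralZr//=.
  - by move=> x _; rewrite lee_fin.
  - by apply: integral_ge0 => z _; rewrite lee_fin.
apply: EFin_inj.
rewrite EFinM !EFin_Ex//; last exact: bmeasM.
transitivity (\int[P]_t h (X t))%E.
  apply: eq_integral => t _; rewrite /h /h1 /h2 /=.
  by rewrite (ger0_norm (p1 t)) (ger0_norm (p2' t)).
rewrite E12; congr (_ * _)%E; apply: eq_integral => t _; rewrite /h1 /h2 /=.
  by rewrite (ger0_norm (p1 t)).
by rewrite (ger0_norm (p2 t)).
Qed.

End Factorization.

(** * Quenched and annealed path sums *)

Section Paths.
Set Implicit Arguments.
Unset Strict Implicit.
Notation shift := Defs.shift.
Variables (R : realType) (d : nat) (u0 : U d).
Implicit Types (z : nat -> U d) (w : Env R d).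

Definition after a z : nat -> U d := fun k => z (a + k)%N.

Definition glue a z z' : nat -> U d := fun k => if (k < a)%N then z k else z' (k - a)%N.

Definition agree a z z' := forall k, (k < a)%N -> z k = z' k.

Lemma agree_glue a z z' : agree a (glue a z z') z.
Proof. by move=> k ka; rewrite /glue ka. Qed.

Lemma after_glue a z z' : after a (glue a z z') = z'.
Proof. by apply/funext => k; rewrite /after /glue ltnNge leq_addr /= addKn. Qed.

Lemma after_after a b z : after b (after a z) = after (a + b) z.
Proof. by apply/funext => k; rewrite /after addnA. Qed.

Lemma agree_after a b z z' : agree (a + b) z z' -> agree b (after a z) (after a z').
Proof. by move=> h k kb; apply: h; rewrite ltn_add2l. Qed.

Lemma agree_le a b z z' : (a <= b)%N -> agree b z z' -> agree a z z'.
Proof. by move=> ab h k ka; apply: h; exact: leq_trans ka ab. Qed.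

Lemma pos_agree a z z' : agree a z z' -> pos z a = pos z' a.
Proof.
move=> h; apply/funext => i; apply: eq_bigr => j _.
by rewrite h.
Qed.

Lemma pos0 z : pos z 0 = @site0 d.
Proof. by apply/funext => i; rewrite /pos big_ord0. Qed.

Lemma pos_after a b z : pos z (a + b) = siteD (pos (after a z) b) (pos z a).
Proof.
by apply/funext => i; rewrite /siteD /pos big_split_ord /= addrC.
Qed.

Lemma shift_shift (m m' : int) (y y' : site d) w :
  shift m y (shift m' y' w) = shift (m + m') (siteD y y') w.
Proof.
apply/funext => n; apply/funext => x; rewrite /Defs.shift addrA; congr w.
by apply/funext => i; rewrite /siteD addrA.
Qed.

Lemma shift_env0 w : shift 0 (@site0 d) w = w.
Proof.
apply/funext => n; apply/funext => x; rewrite /Defs.shift addr0; congr w.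
by apply/funext => i; rewrite /siteD addr0.
Qed.

Lemma shift_pos_after a b z w :
  shift b%:Z (pos (after a z) b) (shift a%:Z (pos z a) w) =
  shift (a + b)%N%:Z (pos z (a + b)) w.
Proof.
have -> : (a + b)%N%:Z = b%:Z + a%:Z by rewrite PoszD addrC.
by rewrite shift_shift pos_after.
Qed.

Lemma weight_agree a z z' w : agree a z z' -> weight w z a = weight w z' a.
Proof.
move=> h; apply: eq_bigr => j _; rewrite h// (pos_agree (z' := z'))//.
by apply: agree_le h; exact: ltnW.
Qed.

(** The quenched Markov property: after [a] steps a fresh walk starts in the environment recentred
    at its position. *)
Lemma weight_after a b z w :
  weight w z (a + b) = weight w z a * weight (shift a%:Z (pos z a) w) (after a z) b.
Proof.
rewrite /weight big_split_ord /=; congr (_ * _); apply: eq_bigr => j _.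
rewrite /Defs.shift -pos_after.
by have -> : (a + j)%N%:Z = j%:Z + a%:Z by rewrite PoszD addrC.
Qed.

Lemma ext_lt L (s : {ffun 'I_L -> U d}) (i : 'I_L) : ext u0 s i = s i.
Proof.
rewrite /ext; case: insubP => [j _ ji|]; last by rewrite ltn_ord.
by congr (s _); exact: val_inj.
Qed.

Lemma ext_ge L (s : {ffun 'I_L -> U d}) k : (L <= k)%N -> ext u0 s k = u0.
Proof. by move=> Lk; rewrite /ext insubN// -leqNgt. Qed.

(** The two step sequences coincide as functions on all of [nat], both being [u0] from index [a + b]
    on, so [F] may be arbitrary. *)
Lemma sum_ext_glue a b (F : (nat -> U d) -> R) :
  \sum_(s : {ffun 'I_(a + b) -> U d}) F (ext u0 s) =
  \sum_(s1 : {ffun 'I_a -> U d}) \sum_(s2 : {ffun 'I_b -> U d})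
    F (glue a (ext u0 s1) (ext u0 s2)).
Proof.
rewrite pair_big /=.
pose h (p : {ffun 'I_a -> U d} * {ffun 'I_b -> U d}) : {ffun 'I_(a + b) -> U d} :=
  [ffun i : 'I_(a + b) => glue a (ext u0 p.1) (ext u0 p.2) i].
pose h' (s : {ffun 'I_(a + b) -> U d}) : {ffun 'I_a -> U d} * {ffun 'I_b -> U d} :=
  ([ffun i => s (lshift b i)], [ffun i => s (rshift a i)]).
have hK : cancel h h'.
  move=> [s1 s2]; congr pair; apply/ffunP => i; rewrite !ffunE /glue /=.
    by rewrite ltn_ord ext_lt.
  by rewrite ltnNge leq_addr /= addKn ext_lt.
have h'K : cancel h' h.
  move=> s; apply/ffunP => i; rewrite !ffunE /glue /=.
  case: split_ordP => j ->.
    by rewrite ext_lt ffunE.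
  by rewrite /= addKn ext_lt ffunE.
rewrite (reindex h) /=; last by exists h' => ? _; [exact: hK|exact: h'K].
apply: eq_bigr => p _; congr F; apply/funext => k.
have [kL|Lk] := ltnP k (a + b).
  by rewrite (ext_lt (h p) (Ordinal kL)) ffunE.
rewrite ext_ge// /glue ltnNge (leq_trans (leq_addr b a) Lk) /= ext_ge//.
by rewrite leq_subRL ?Lk// (leq_trans (leq_addr b a) Lk).
Qed.

Lemma sum_ext1 (F : (nat -> U d) -> R) (F' : U d -> R) :
  (forall z, F z = F' (z 0%N)) ->
  \sum_(s : {ffun 'I_1 -> U d}) F (ext u0 s) = \sum_u F' u.
Proof.
move=> FF'; rewrite (reindex (fun u => [ffun _ : 'I_1 => u])) /=.
  by apply: eq_bigr => u _; rewrite FF' (ext_lt _ ord0) ffunE.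
exists (fun s : {ffun 'I_1 -> U d} => s ord0) => [u _|s _]; first by rewrite ffunE.
by apply/ffunP => i; rewrite ffunE (ord1 i).
Qed.

Lemma sum_ext0 (F : (nat -> U d) -> R) c :
  (forall z, F z = c) -> \sum_(s : {ffun 'I_0 -> U d}) F (ext u0 s) = c.
Proof.
move=> Fc; under eq_bigr do rewrite Fc.
by rewrite sumr_const card_ffun card_ord expn0.
Qed.

Definition stochastic w :=
  forall n x, (forall u, 0 <= w n x u) /\ \sum_(u : U d) w n x u = 1.

Lemma stochastic_shift m y w : stochastic w -> stochastic (shift m y w).
Proof. by move=> h n x; exact: h. Qed.

Lemma stochastic_le1 w n x u : stochastic w -> w n x u <= 1.
Proof.
move=> /(_ n x)[h <-]; rewrite (bigD1 u)//= lerDl.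
by apply: sumr_ge0 => v _; exact: h.
Qed.

Lemma weight_ge0 w z L : stochastic w -> 0 <= weight w z L.
Proof. by move=> h; apply: prodr_ge0 => j _; exact: (h _ _).1. Qed.

Lemma weight_le1 w z L : stochastic w -> weight w z L <= 1.
Proof.
move=> h; apply: prodr_ile1 => j _.
by rewrite (h _ _).1 stochastic_le1.
Qed.

(** The induction ranges over all stochastic environments, since peeling off the first step
    recentres the environment. *)
Lemma sum_weight w b : stochastic w ->
  \sum_(s : {ffun 'I_b -> U d}) weight w (ext u0 s) b = 1.
Proof.
elim: b w => [|b IH] w hw.
  by apply: (sum_ext0 (F := fun z => weight w z 0)) => z; rewrite /weight big_ord0.
rewrite -[b.+1]/(1 + b)%N (sum_ext_glue 1 b (fun z => weight w z (1 + b))).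
transitivity (\sum_(s1 : {ffun 'I_1 -> U d}) weight w (ext u0 s1) 1).
  apply: eq_bigr => s1 _.
  under eq_bigr do rewrite weight_after after_glue
    (weight_agree _ (agree_glue _ _)) (pos_agree (agree_glue _ _)).
  by rewrite -mulr_sumr IH ?mulr1//; exact: stochastic_shift.
rewrite (sum_ext1 (F := fun z => weight w z 1) (F' := fun u => w 0 (@site0 d) u)).
  exact: (hw _ _).2.
by move=> z; rewrite /weight big_ord1 pos0.
Qed.

End Paths.

(** * Annealed and tilted expectations *)

Section Annealed.
Set Implicit Arguments.
Unset Strict Implicit.
Notation shift := Defs.shift.
Variables (R : realType) (d : nat) (u0 : U d).
Notation Eenv Pt := (g_sigma_algebraType (@coord_sys R d Pt)).
Implicit Types (z : nat -> U d) (w : Env R d).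

Variables (dT : measure_display) (T : measurableType dT) (P : probability T R).
Variable pi : int -> site d -> U d -> T -> R.
Hypothesis Hmeas : forall n x u, measurable_fun setT (pi n x u).
Hypothesis Hprob : forall n x t,
  (forall u, 0 <= pi n x u t) /\ \sum_(z : U d) pi n x z t = 1.
Hypothesis Hiid : iid_field P pi.
Variable theta : 'I_d -> R.

Notation om := (omega pi).

Lemma stochastic_omega t : stochastic (om t).
Proof. by move=> n x; exact: Hprob. Qed.

Definition tame (G : Env R d -> (nat -> U d) -> R) :=
  forall z, bmeas (fun t => G (om t) z).

(* The annealed expectation E_{0,0} of a function of the environment and of the first [L] steps. *)
Definition AE L (G : Env R d -> (nat -> U d) -> R) : R :=
  \sum_(s : {ffun 'I_L -> U d})
    Ex P (fun t => weight (om t) (ext u0 s) L * G (om t) (ext u0 s)).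

Lemma measurable_weight (Pt : int -> Prop) z a :
  (forall j : nat, (j < a)%N -> Pt j) ->
  measurable_fun setT ((fun w => weight w z a) : Eenv Pt -> R).
Proof.
move=> h; apply: measurable_prod => j _.
by apply: measurable_coord; exact: h.
Qed.

Lemma bmeas_weight_shift (m : int) (y : site d) z a :
  bmeas (fun t => weight (shift m y (om t)) z a).
Proof.
split.
  apply: (@measurableT_comp _ _ _ _ (Eenv (fun=> True)) _ (fun w => weight w z a)).
    exact: measurable_weight.
  exact: measurable_shift_omega.
have st t : stochastic (shift m y (om t)).
  by apply: stochastic_shift; exact: stochastic_omega.
by exists 1 => t; rewrite ger0_norm ?weight_ge0// weight_le1.
Qed.

Lemma bmeas_weight z a : bmeas (fun t => weight (om t) z a).
Proof.
have := bmeas_weight_shift 0 (@site0 d) z a.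
by under eq_fun do rewrite shift_env0.
Qed.

Lemma bmeas_weightM G z a : tame G -> bmeas (fun t => weight (om t) z a * G (om t) z).
Proof. by move=> tG; apply: bmeasM; [exact: bmeas_weight|exact: tG]. Qed.

Lemma eq_AE L G G' : (forall t z, G (om t) z = G' (om t) z) -> AE L G = AE L G'.
Proof. by move=> h; apply: eq_bigr => s _; apply: eq_Ex => t; rewrite h. Qed.

Lemma AE_D L G G' : tame G -> tame G' ->
  AE L (fun w z => G w z + G' w z) = AE L G + AE L G'.
Proof.
move=> tG tG'; rewrite /AE -big_split; apply: eq_bigr => s _ /=.
rewrite -ExD; [|exact: bmeas_weightM|exact: bmeas_weightM].
by apply: eq_Ex => t; rewrite mulrDr.
Qed.

Lemma AE_Z L c G : tame G -> AE L (fun w z => c * G w z) = c * AE L G.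
Proof.
move=> tG; rewrite /AE mulr_sumr; apply: eq_bigr => s _ /=.
rewrite -ExZ; last exact: bmeas_weightM.
by apply: eq_Ex => t; rewrite mulrCA.
Qed.

Lemma le_AE L G G' : tame G -> tame G' ->
  (forall t z, G (om t) z <= G' (om t) z) -> AE L G <= AE L G'.
Proof.
move=> tG tG' h; apply: ler_sum => s _.
apply: le_Ex; [exact: bmeas_weightM|exact: bmeas_weightM|] => t.
by rewrite ler_wpM2l// weight_ge0//; exact: stochastic_omega.
Qed.

(** The surplus steps sum to one for each fixed environment, by [sum_weight]; no averaging is
    involved. This reconciles the different horizons in the conditional probability. *)
Lemma AE_extend a b G : tame G ->
  (forall w z z', agree a z z' -> G w z = G w z') -> AE (a + b) G = AE a G.
Proof.
move=> tG GA; rewrite /AE.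
rewrite (sum_ext_glue u0 a b (fun z => Ex P (fun t => weight (om t) z (a + b) * G (om t) z))).
apply: eq_bigr => s1 _; rewrite -Ex_sum.
  apply: eq_Ex => t.
  transitivity (weight (om t) (ext u0 s1) a * G (om t) (ext u0 s1) *
    \sum_(s2 : {ffun 'I_b -> U d})
      weight (shift a%:Z (pos (ext u0 s1) a) (om t)) (ext u0 s2) b); last first.
    by rewrite sum_weight ?mulr1//; apply: stochastic_shift; exact: stochastic_omega.
  rewrite mulr_sumr; apply: eq_bigr => s2 _.
  rewrite weight_after after_glue (GA _ _ _ (agree_glue _ _)).
  rewrite (weight_agree _ (agree_glue _ _)) (pos_agree (agree_glue _ _)).
  by rewrite mulrAC.
by move=> s2; exact: bmeas_weightM.
Qed.

Lemma tameD G G' : tame G -> tame G' -> tame (fun w z => G w z + G' w z).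
Proof. by move=> h h' z; exact: bmeasD. Qed.
Lemma tameM G G' : tame G -> tame G' -> tame (fun w z => G w z * G' w z).
Proof. by move=> h h' z; exact: bmeasM. Qed.
Lemma tame_path (g : (nat -> U d) -> R) : tame (fun _ z => g z).
Proof. by move=> z; exact: bmeas_cst. Qed.
Lemma tame_sum (I : Type) (s : seq I) G : (forall i, tame (G i)) ->
  tame (fun w z => \sum_(i <- s) G i w z).
Proof. by move=> h z; apply: bmeas_sum => i; exact: h. Qed.
Lemma tame_prod (I : Type) (s : seq I) G : (forall i, tame (G i)) ->
  tame (fun w z => \prod_(i <- s) G i w z).
Proof. by move=> h z; apply: bmeas_prod => i; exact: h. Qed.
Lemma tame_expR G : tame G -> tame (fun w z => expR (G w z)).
Proof. by move=> h z; exact: bmeas_expR. Qed.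
Lemma tame_lt (c : R) G : tame G -> tame (fun w z => (c < G w z)%R%:R).
Proof.
move=> h z; apply: bmeas_bool; apply: measurable_fun_ltr => //.
by have [] := h z.
Qed.

Lemma AE_sum L (I : Type) (s : seq I) G : (forall i, tame (G i)) ->
  AE L (fun w z => \sum_(i <- s) G i w z) = \sum_(i <- s) AE L (G i).
Proof.
move=> tG; rewrite /AE exchange_big; apply: eq_bigr => p _ /=.
rewrite -Ex_sum; last by move=> i; exact: bmeas_weightM.
by apply: eq_Ex => t; rewrite mulr_sumr.
Qed.

Local Notation Lam := (Lambda_c P pi theta).

(** The density exp(<theta, X_L> - L Lambda_c) in product form, which is multiplicative under
    concatenation of words. *)
Definition tilt z L : R := \prod_(j < L) expR (dotU theta (z j) - Lam).

Lemma tilt_ge0 z L : 0 <= tilt z L.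
Proof. by apply: prodr_ge0 => j _; exact: expR_ge0. Qed.

Lemma tilt_after a b z : tilt z (a + b) = tilt z a * tilt (after a z) b.
Proof. by rewrite /tilt big_split_ord. Qed.

Lemma tilt_agree a z z' : agree a z z' -> tilt z a = tilt z' a.
Proof. by move=> h; apply: eq_bigr => j _; rewrite h. Qed.

Lemma tiltE z L :
  tilt z L = expR (\sum_i theta i * (pos z L i)%:~R - L%:R * Lam).
Proof.
rewrite /tilt -expR_sum sumrB sumr_const card_ord mulr_natl; congr (expR (_ - _)).
rewrite /dotU exchange_big; apply: eq_bigr => i _ /=.
by rewrite /pos rmorph_sum mulr_sumr.
Qed.

(** The point is that the argument of [ln] is positive: were the sum zero, every [q] would vanish,
    but they add up to one. *)
Lemma expR_Lambda : expR Lam = \sum_(z : U d) q P pi z * expR (dotU theta z).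
Proof.
have qE (z : U d) : q P pi z = Ex P (pi 0 (@site0 d) z) by [].
have bpi (z : U d) : bmeas (pi 0 (@site0 d) z).
  split => //; exists 1 => t; rewrite ger0_norm; first exact: stochastic_le1 (stochastic_omega t).
  by have [] := Hprob 0 (@site0 d) t.
have q0 (z : U d) : 0 <= q P pi z.
  rewrite qE -(Ex_cst P 0); apply: le_Ex => //; first exact: bmeas_cst.
  by move=> t; have [] := Hprob 0 (@site0 d) t.
have q1 : \sum_(z : U d) q P pi z = 1.
  under eq_bigr do rewrite qE.
  rewrite -Ex_sum// -[RHS](Ex_cst P 1); apply: eq_Ex => t.
  by have [] := Hprob 0 (@site0 d) t.
rewrite lnK// posrE lt_neqAle; apply/andP; split; last first.
  by apply: sumr_ge0 => z _; rewrite mulr_ge0// expR_ge0.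
apply/eqP => /esym /eqP.
rewrite psumr_eq0; last by move=> z _; rewrite mulr_ge0// expR_ge0.
move=> /allP h; move: q1; rewrite big1; first by move/eqP; rewrite eq_sym oner_eq0.
move=> z _; have := h z (mem_index_enum z).
by rewrite /= mulf_eq0 => /orP[/eqP //|]; rewrite gt_eqF// expR_gt0.
Qed.

(* E_{0,0}[e^{<theta, X_L> - L Lambda_c(theta)} G], see [tiltE]. *)
Definition TE L (G : Env R d -> (nat -> U d) -> R) : R :=
  AE L (fun w z => tilt z L * G w z).

Lemma tame_tilt L G : tame G -> tame (fun w z => tilt z L * G w z).
Proof. by move=> tG; apply: tameM => //; exact: tame_path. Qed.

Lemma eq_TE L G G' : (forall t z, G (om t) z = G' (om t) z) -> TE L G = TE L G'.
Proof. by move=> h; apply: eq_AE => t z; rewrite h. Qed.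

Lemma TE_D L G G' : tame G -> tame G' ->
  TE L (fun w z => G w z + G' w z) = TE L G + TE L G'.
Proof.
move=> tG tG'; rewrite -AE_D; [|exact: tame_tilt|exact: tame_tilt].
by apply: eq_AE => t z; rewrite mulrDr.
Qed.

Lemma TE_Z L c G : tame G -> TE L (fun w z => c * G w z) = c * TE L G.
Proof.
move=> tG; rewrite -AE_Z; last exact: tame_tilt.
by apply: eq_AE => t z; rewrite mulrCA.
Qed.

Lemma le_TE L G G' : tame G -> tame G' ->
  (forall t z, G (om t) z <= G' (om t) z) -> TE L G <= TE L G'.
Proof.
move=> tG tG' h; apply: le_AE; [exact: tame_tilt|exact: tame_tilt|] => t z.
by rewrite ler_wpM2l// tilt_ge0.
Qed.

Lemma TE_ge0 L G : (forall t z, 0 <= G (om t) z) -> 0 <= TE L G.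
Proof.
move=> G0; apply: sumr_ge0 => s _; apply: Rintegral_ge0 => t _.
by rewrite mulr_ge0 ?weight_ge0 ?mulr_ge0 ?tilt_ge0//; exact: stochastic_omega.
Qed.

Lemma TE_sum L (I : Type) (s : seq I) G : (forall i, tame (G i)) ->
  TE L (fun w z => \sum_(i <- s) G i w z) = \sum_(i <- s) TE L (G i).
Proof.
move=> tG; rewrite -AE_sum; last by move=> i; exact: tame_tilt.
by apply: eq_AE => t z; rewrite mulr_sumr.
Qed.

(** [Pt] lists the time levels that may be read. Nonnegativity is what the product formula asks
    for. *)
Definition nice (Pt : int -> Prop) (G : Env R d -> (nat -> U d) -> R) :=
  (forall z, measurable_fun setT (G^~ z : Eenv Pt -> R)) /\
  exists C, forall w z, 0 <= G w z <= C.

Lemma nice_tame_shift Pt G (m : (nat -> U d) -> int) (y : (nat -> U d) -> site d)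
    (r : (nat -> U d) -> (nat -> U d)) :
  nice Pt G -> tame (fun w z => G (shift (m z) (y z) w) (r z)).
Proof.
move=> [mG [C GC]] z; split.
  apply: (@measurableT_comp _ _ _ _ (Eenv Pt) _ (G^~ (r z))); first exact: mG.
  exact: measurable_shift_omega.
exists C => t; have /andP[g0 gC] := GC (shift (m z) (y z) (om t)) (r z).
by rewrite ger0_norm.
Qed.

Lemma nice_tame Pt G : nice Pt G -> tame G.
Proof.
move=> [mG [C GC]] z; split.
  apply: (@measurableT_comp _ _ _ _ (Eenv Pt) _ (G^~ z)); first exact: mG.
  exact: measurable_omega.
exists C => t; have /andP[g0 gC] := GC (om t) z.
by rewrite ger0_norm.
Qed.

(** For fixed words the position [pos z a] is deterministic. Weight, tilt and [G1] of the first word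
    read levels below [a], those of the second word levels from [a] on, so [Ex_factor] applies; its
    value does not depend on the position, and the double sum splits. *)
Lemma TE_block a b G1 G2 :
  nice (fun n => (n < a%:Z)%R) G1 -> (forall w z z', agree a z z' -> G1 w z = G1 w z') ->
  nice (fun n => (0 <= n)%R) G2 ->
  TE (a + b) (fun w z => G1 w z * G2 (shift a%:Z (pos z a) w) (after a z)) =
  TE a G1 * TE b G2.
Proof.
move=> n1 A1 n2; rewrite /TE /AE.
rewrite (sum_ext_glue u0 a b (fun z => Ex P (fun t => weight (om t) z (a + b) *
  (tilt z (a + b) * (G1 (om t) z * G2 (shift a%:Z (pos z a) (om t)) (after a z)))))).
rewrite big_distrlr /=; apply: eq_bigr => s1 _; apply: eq_bigr => s2 _.
set z1 := ext u0 s1; set z2 := ext u0 s2.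
pose g1 w := weight w z1 a * (tilt z1 a * G1 w z1).
pose g2 w := weight w z2 b * (tilt z2 b * G2 w z2).
transitivity (Ex P (fun t => g1 (om t) * g2 (shift a%:Z (pos z1 a) (om t)))).
  apply: eq_Ex => t; rewrite weight_after tilt_after after_glue.
  rewrite (A1 _ _ _ (agree_glue _ _)) (tilt_agree (agree_glue _ _)).
  rewrite (weight_agree _ (agree_glue _ _)) (pos_agree (agree_glue _ _)).
  rewrite /g1 /g2; set W := weight _ _ _; set V := weight _ _ _.
  by ring.
have g10 t : 0 <= g1 (om t).
  rewrite mulr_ge0 ?weight_ge0//; first exact: stochastic_omega.
  by rewrite mulr_ge0 ?tilt_ge0//; have [_ [C /(_ (om t) z1) /andP[]]] := n1.
have g20 w : stochastic w -> 0 <= g2 w.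
  move=> sw; rewrite mulr_ge0 ?weight_ge0//.
  by rewrite mulr_ge0 ?tilt_ge0//; have [_ [C /(_ w z2) /andP[]]] := n2.
rewrite (Ex_factor Hmeas Hiid (a := a%:Z) (g1 := g1) (g2 := g2))//.
- apply: measurable_funM; first exact: measurable_weight.
  by apply: measurable_funM => //; exact: n1.1.
- apply: measurable_funM; first exact: measurable_weight.
  by apply: measurable_funM => //; exact: n2.1.
- apply: bmeasM; first exact: bmeas_weight.
  by apply: bmeasM; [exact: bmeas_cst|exact: nice_tame n1 _].
- apply: bmeasM; first exact: bmeas_weight.
  by apply: bmeasM; [exact: bmeas_cst|exact: nice_tame n2 _].
- apply: bmeasM; first exact: bmeas_weight_shift.
  apply: bmeasM; first exact: bmeas_cst.
  exact: (nice_tame_shift (fun=> a%:Z) (fun=> pos z1 a) (fun=> z2) n2 z1).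
- by move=> t; apply: g20; exact: stochastic_omega.
- by move=> t; apply: g20; apply: stochastic_shift; exact: stochastic_omega.
Qed.

Lemma nice1 Pt : nice Pt (fun _ _ => 1).
Proof. by split => [z|]; [exact: measurable_cst|exists 1 => w z; rewrite ler01 lexx]. Qed.

Lemma TE_step (g : U d -> R) : TE 1 (fun _ z => g (z 0%N)) =
  \sum_(u : U d) q P pi u * expR (dotU theta u - Lam) * g u.
Proof.
rewrite /TE /AE (sum_ext1 u0
  (F := fun z => Ex P (fun t => weight (om t) z 1 * (tilt z 1 * g (z 0%N))))
  (F' := fun u => q P pi u * expR (dotU theta u - Lam) * g u))// => z.
have -> : q P pi (z 0%N) = Ex P (pi 0 (@site0 d) (z 0%N)) by [].
rewrite -mulrA [RHS]mulrC -ExZ; last first.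
  split => //; exists 1 => t; rewrite ger0_norm.
    exact: stochastic_le1 (stochastic_omega t).
  by have [] := Hprob 0 (@site0 d) t.
by apply: eq_Ex => t; rewrite /weight /tilt !big_ord1 pos0 mulrC.
Qed.

(** One step has mass one because the tilted [q] sums to exp(Lambda_c - Lambda_c); [TE_block]
    multiplies the masses of successive steps. *)
Lemma TE1 L : TE L (fun _ _ => 1) = 1.
Proof.
elim: L => [|L IH].
  rewrite /TE /AE (sum_ext0 u0 (F := fun z => Ex P (fun t => weight (om t) z 0 *
    (tilt z 0 * 1))) (c := 1))// => z.
  rewrite -[RHS](Ex_cst P 1); apply: eq_Ex => t.
  by rewrite /weight /tilt !big_ord0 !mul1r.
transitivity (TE (1 + L) (fun _ _ => 1 * 1)); first by apply: eq_TE => t z; rewrite mulr1.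
rewrite (@TE_block 1 L (fun _ _ => 1) (fun _ _ => 1))//; [|exact: nice1|exact: nice1].
rewrite IH mulr1 (TE_step (fun=> 1)).
under eq_bigr do rewrite mulr1 expRD mulrA.
by rewrite -mulr_suml -expR_Lambda -expRD subrr expR0.
Qed.

Lemma TE_cst L c : TE L (fun _ _ => c) = c.
Proof.
transitivity (c * TE L (fun _ _ => 1)); last by rewrite TE1 mulr1.
rewrite -TE_Z; first by apply: eq_TE => t z; rewrite mulr1.
exact: (tame_path (fun=> 1)).
Qed.

(** Unlike in [AE_extend], the surplus steps carry tilt factors that need not sum to one in a fixed
    environment; their mass is one only on average, through [TE_block]. *)
Lemma TE_extend a b (G : (nat -> U d) -> R) C : (forall z, `|G z| <= C) ->
  (forall z z', agree a z z' -> G z = G z') ->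
  TE (a + b) (fun _ z => G z) = TE a (fun _ z => G z).
Proof.
move=> GC GA.
have tG (c : R) (H : (nat -> U d) -> R) : tame (fun _ z => c + H z).
  exact: (tame_path (fun z => c + H z)).
(* Adding [C] makes the function nonnegative, as [TE_block] requires. *)
have E L : TE L (fun _ z => G z) = - C + TE L (fun _ z => C + G z).
  rewrite -(TE_cst L (- C)) -TE_D//; last exact: (tame_path (fun=> - C)).
  by apply: eq_TE => t z; rewrite addrA addNr add0r.
have G0 z : 0 <= C + G z <= C + C.
  by have := GC z; rewrite ler_norml => /andP[h1 h2]; apply/andP; split; lra.
rewrite !E; congr (_ + _).
transitivity (TE a (fun _ z => C + G z) * TE b (fun _ _ => 1)); last by rewrite TE1 mulr1.
rewrite -TE_block//.
- by apply: eq_TE => t z; rewrite mulr1.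
- by split => [z|]; [exact: measurable_cst|exists (C + C) => _ z].
- by move=> _ z z' /GA ->.
- exact: nice1.
Qed.

End Annealed.

(** * Large deviations under the tilted measure *)

Section PartialSums.
Set Implicit Arguments.
Unset Strict Implicit.
Variable R : realType.
Implicit Types a : nat -> R.

(** exp(x) is at most 1/(1-x), and (1+x+2x^2)(1-x) = 1 + x^2(1-2x). *)
Lemma expR_le_quadratic (x : R) : x <= 1 / 2 -> expR x <= 1 + x + 2 * x ^+ 2.
Proof.
move=> x2; have h : 1 - x <= expR (- x) by exact: expR_ge1Dx.
have x1 : 0 < 1 - x by lra.
have -> : expR x = (expR (- x))^-1 by rewrite expRN invrK.
apply: (@le_trans _ _ (1 - x)^-1); first by rewrite lef_pV2 ?posrE ?expR_gt0.
rewrite -[X in X <= _]mul1r ler_pdivrMr//.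
have : 0 <= x ^+ 2 * (1 - 2 * x) by rewrite mulr_ge0 ?sqr_ge0//; lra.
by lra.
Qed.

Lemma psumD a m n : \sum_(j < m + n) a j = \sum_(j < m) a j + \sum_(j < n) a (m + j)%N.
Proof. by rewrite big_split_ord. Qed.

Lemma psum_norm a C n : (forall j, `|a j| <= C) -> `|\sum_(j < n) a j| <= n%:R * C.
Proof.
move=> aC; apply: le_trans (ler_norm_sum _ _ _) _.
apply: (@le_trans _ _ (\sum_(j < n) C)); first by apply: ler_sum => j _.
by rewrite sumr_const card_ord mulr_natl.
Qed.

Lemma psum_residues a L m :
  \sum_(j < m * L) a j = \sum_(r < L) \sum_(i < m) a (r + i * L)%N.
Proof.
elim: m => [|m IH].
  by rewrite mul0n big_ord0 big1// => r _; rewrite big_ord0.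
rewrite mulSn addnC psumD IH -big_split /=; apply: eq_bigr => r _.
by rewrite big_ord_recr /= addnC.
Qed.

(** The range is moved up by [N] so that a summand looking [N] levels back starts its window at r +
    iL. The error counts [N] terms lost at the bottom, [N] gained at the top and an incomplete block
    of fewer than [L]. *)
Lemma psum_le_residues a C N L n : (forall j, `|a j| <= C) -> (0 < L)%N ->
  \sum_(j < n) a j <=
  \sum_(r < L) \sum_(i < n %/ L) a (N + (r + i * L))%N + (2 * N + L)%:R * C.
Proof.
move=> aC L0; have C0 : 0 <= C by exact: le_trans (aC 0%N).
have E1 := psumD a n N.
have E2 : \sum_(j < n + N) a j = \sum_(j < N) a j +
    \sum_(j < n %/ L * L) a (N + j)%N + \sum_(j < n %% L) a (N + n %/ L * L + j)%N.
  have -> : (n + N = N + n %/ L * L + n %% L)%N.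
    by rewrite addnC {1}(divn_eq n L) addnA.
  by rewrite psumD [X in X + _]psumD.
rewrite -(psum_residues (fun j => a (N + j)%N)).
have h1 := psum_norm N aC.
have h2 := @psum_norm (fun j => a (n + j)%N) C N (fun j => aC _).
have h3 := @psum_norm (fun j => a (N + n %/ L * L + j)%N) C (n %% L) (fun j => aC _).
have h4 : (n %% L)%:R * C <= L%:R * C.
  by rewrite ler_wpM2r// ler_nat ltnW// ltn_mod.
have -> : (2 * N + L)%:R * C = N%:R * C + N%:R * C + L%:R * C.
  by rewrite natrD natrM; ring.
move: h1 h2 h3 h4; rewrite !ler_norml => /andP[_ h1] /andP[h2 _] /andP[_ h3] h4.
by lra.
Qed.

End PartialSums.

(** * Exponential bound along residue classes *)

Section Chernoff.
Set Implicit Arguments.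
Unset Strict Implicit.
Notation shift := Defs.shift.
Variables (R : realType) (d : nat) (u0 : U d).
Notation Eenv Pt := (g_sigma_algebraType (@coord_sys R d Pt)).

Variables (dT : measure_display) (T : measurableType dT) (P : probability T R).
Variable pi : int -> site d -> U d -> T -> R.
Hypothesis Hmeas : forall n x u, measurable_fun setT (pi n x u).
Hypothesis Hprob : forall n x t,
  (forall u, 0 <= pi n x u t) /\ \sum_(z : U d) pi n x z t = 1.
Hypothesis Hiid : iid_field P pi.
Variable theta : 'I_d -> R.

Notation om := (omega pi).
Notation TE := (TE u0 P pi theta).

Definition seen (g : Env R d -> (nat -> U d) -> R) (j : nat) : Env R d -> (nat -> U d) -> R :=
  fun w z => g (shift j%:Z (pos z j) w) (after j z).

Lemma seen_after g a b w z :
  seen g b (shift a%:Z (pos z a) w) (after a z) = seen g (a + b) w z.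
Proof. by rewrite /seen shift_pos_after after_after. Qed.

Lemma seen0 g w z : seen g 0 w z = g w z.
Proof. by rewrite /seen pos0 shift_env0. Qed.

Lemma nice_seen (Pt Pt' : int -> Prop) g j :
  (forall n, Pt n -> Pt' (n + j%:Z)) -> nice Pt g -> nice Pt' (seen g j).
Proof.
move=> PP' [mg [C gC]]; split => [z|]; last by exists C => w z; exact: gC.
apply: (@measurableT_comp _ _ _ _ (Eenv Pt) _ (g^~ (after j z))); first exact: mg.
exact: measurable_shift.
Qed.

Lemma nice_prod Pt (I : Type) (s : seq I) (G : I -> Env R d -> (nat -> U d) -> R) :
  (forall i, nice Pt (G i)) -> nice Pt (fun w z => \prod_(i <- s) G i w z).
Proof.
move=> nG; elim: s => [|i s [mIH [C IHC]]].
  by under eq_fun do under eq_fun do rewrite big_nil; exact: nice1.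
have [mi [D iD]] := nG i.
under eq_fun do under eq_fun do rewrite big_cons.
split => [z|]; first by apply: measurable_funM; [exact: mi|exact: mIH].
exists (D * C) => w z; have /andP[a b] := iD w z; have /andP[a' b'] := IHC w z.
by rewrite mulr_ge0//= ler_pM.
Qed.

(** [h] reads only levels 0 to L-1 and the first L steps, so its copies at multiples of L use
    disjoint windows. The two [nice] hypotheses let [h] serve as the past factor of [TE_block] and
    its later copies as the future one; the spare [b] steps have mass one. *)
Lemma TE_renewal L h m b :
  nice (fun n => (n < L%:Z)%R) h -> nice (fun n => (0 <= n)%R) h ->
  (forall w z z', agree L z z' -> h w z = h w z') ->
  TE (m * L + b) (fun w z => \prod_(i < m) seen h (i * L) w z) = TE L h ^+ m.
Proof.
move=> nL n0 A; elim: m => [|m IH].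
  rewrite expr0 -[RHS](TE1 u0 Hmeas Hprob Hiid theta b).
  by apply: eq_TE => t z; rewrite big_ord0.
rewrite mulSn -addnA exprS -IH -(TE_block _ Hmeas)//; last first.
  apply: nice_prod => i; apply: nice_seen n0 => n n0.
  by rewrite addr_ge0.
apply: eq_TE => t z; rewrite big_ord_recl seen0 /=; congr (_ * _).
by apply: eq_bigr => i _; rewrite seen_after /bump /= add1n mulSn.
Qed.

Lemma TE_renewal_delayed L r h m b :
  nice (fun n => (n < L%:Z)%R) h -> nice (fun n => (0 <= n)%R) h ->
  (forall w z z', agree L z z' -> h w z = h w z') ->
  TE (r + (m * L + b)) (fun w z => \prod_(i < m) seen h (r + i * L) w z) = TE L h ^+ m.
Proof.
move=> nL n0 A; rewrite -(TE_renewal m b nL n0 A).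
transitivity (TE r (fun _ _ => 1) *
    TE (m * L + b) (fun w z => \prod_(i < m) seen h (i * L) w z)); last first.
  by rewrite (TE1 u0 Hmeas Hprob Hiid theta r) mul1r.
rewrite -(TE_block _ Hmeas)//.
- apply: eq_TE => t z; rewrite mul1r /=; apply: eq_bigr => i _.
  by rewrite seen_after.
- exact: nice1.
- apply: nice_prod => i; apply: nice_seen n0 => n n0.
  by rewrite addr_ge0.
Qed.

Variables N M K : nat.
(** Looked at from time N, an observable reads levels 0 to N+M and steps N to N+K-1; a window of
    length L contains both. *)
Let L := (N + M + K).+1.

Definition observable (C : R) (g : Env R d -> (nat -> U d) -> R) :=
  [/\ forall w z, `|g w z| <= C,
      forall w z z', agree K z z' -> g w z = g w z' &
      forall z, meas_wrt (@Bplus R d (- (N%:Z))) (g^~ z) /\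
                meas_wrt (@Bminus R d (M%:Z)) (g^~ z)].

Lemma observable_measurable C g z : observable C g ->
  measurable_fun setT (g^~ z : Eenv (fun n => (- N%:Z <= n)%R) -> R) /\
  measurable_fun setT (g^~ z : Eenv (fun n => (n <= M%:Z)%R) -> R).
Proof.
move=> [_ _ /(_ z)[m1 m2]]; split=> _ B mB; rewrite setTI.
  exact: m1.
exact: m2.
Qed.

Lemma tame_observable C g j : observable C g -> tame pi (seen g j).
Proof.
move=> og z; have [gC _ _] := og; split; last by exists C => t; exact: gC.
apply: (@measurableT_comp _ _ _ _ (Eenv (fun n => (- N%:Z <= n)%R)) _ (g^~ (after j z))).
  by have [] := observable_measurable (after j z) og.
exact: measurable_shift_omega.
Qed.

(** The vanishing mean removes the linear term of [expR_le_quadratic], leaving 1 + 2(lC)^2. *)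
Lemma mgf_le C g l : observable C g -> TE L (seen g N) = 0 ->
  0 <= l -> l * C <= 1 / 2 ->
  TE L (fun w z => expR (l * seen g N w z)) <= expR (2 * (l * C) ^+ 2).
Proof.
move=> og g0 l0 lC; have [gC _ _] := og.
have tg := tame_observable N og.
have C0 : 0 <= C by exact: le_trans (normr_ge0 _) (gC (fun _ _ _ => 0) (fun=> u0)).
have tc c : tame pi (fun _ _ => c) by exact: tame_path.
have tlg : tame pi (fun w z => l * seen g N w z) by exact: tameM.
apply: (@le_trans _ _ (TE L (fun w z => (1 + 2 * (l * C) ^+ 2) * 1 + l * seen g N w z))).
  apply: le_TE => //; first exact: tame_expR.
    by apply: tameD.
  move=> t z; set x := l * _.
  have xC : `|x| <= l * C 
    by rewrite normrM (ger0_norm l0) ler_wpM2l//; exact: gC.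
  apply: le_trans (expR_le_quadratic _) _.
    by apply: le_trans (ler_norm _) (le_trans xC _).
  have : x ^+ 2 <= (l * C) ^+ 2 by rewrite -real_normK ?num_real// lerXn2r ?nnegrE// mulr_ge0.
  by lra.
rewrite TE_D// TE_Z// TE1// TE_Z// g0 mulr0 addr0 mulr1.
exact: expR_ge1Dx.
Qed.

(** A union bound over residue classes, then the exponential Markov inequality in each. The
    constants are chosen before [g], so that both tails can later share them. *)
Lemma upper_deviation (C eps : R) : 0 < C -> 0 < eps ->
  exists c A : R, [/\ 0 < c, 0 <= A &
    forall g, observable C g -> TE L (seen g N) = 0 ->
    forall n, TE (n + L) (fun w z => (n%:R * eps < \sum_(j < n) seen g j w z)%R%:R) <=
      A * expR (- (c * n%:R))].
Proof.
move=> C0 eps0.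
(* small enough for [mgf_le] and for 2 (l C)^2 <= l eps / 2 *)
pose l : R := Num.min (1 / (2 * C)) (eps / (4 * C ^+ 2)).
have l0 : 0 < l by rewrite lt_min !divr_gt0// ?mulr_gt0 ?exprn_gt0.
have lC : l * C <= 1 / 2.
  have : l <= 1 / (2 * C) by rewrite ge_min lexx.
  by rewrite ler_pdivlMr ?mulr_gt0//; lra.
have lC2 : l * (4 * C ^+ 2) <= eps.
  have : l <= eps / (4 * C ^+ 2) by rewrite ge_min lexx orbT.
  by rewrite ler_pdivlMr ?mulr_gt0 ?exprn_gt0.
have L0 : (0 : R) < L%:R by rewrite ltr0n.
(* With about n/L blocks per class, the threshold contributes -l eps n/L and the moment bound at
   most half of that back; the boundary error goes into the prefactor. *)
exists (l * eps / (2 * L%:R)), (L%:R * expR (l * ((2 * N + L)%:R * C) / L%:R)).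
split; first by rewrite divr_gt0 ?mulr_gt0.
  by rewrite mulr_ge0 ?expR_ge0// ltW.
move=> g og g0 n; have [gC gK _] := og.
set B := (2 * N + L)%:R * C.
(* The share of the threshold that falls to one residue class. *)
pose x := (n%:R * eps - B) / L%:R.
set m := (n %/ L)%N.
pose h : Env R d -> (nat -> U d) -> R := fun w z => expR (l * seen g N w z).
have th r : tame pi (fun w z => \prod_(i < m) seen h (r + i * L) w z).
  apply: tame_prod => i; apply: tame_expR; apply: tameM; first exact: tame_path.
  move=> z; have := tame_observable (r + i * L + N) og z.
  by congr bmeas; apply/funext => t; rewrite -seen_after.
have hA w z z' : agree L z z' -> h w z = h w z'.
  move=> zz'; rewrite /h /seen (@pos_agree _ N z z'); last first.
    by apply: agree_le zz'; rewrite /L; lia.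
  rewrite (gK _ (after N z) (after N z'))//; apply: agree_after.
  by apply: agree_le zz'; rewrite /L; lia.
have hle w z : 0 <= h w z <= expR (l * C).
  rewrite expR_ge0 /= ler_expR ler_wpM2l ?(ltW l0)//.
  exact: le_trans (ler_norm _) (gC _ _).
have hL : nice (fun n => (n < L%:Z)%R) h.
  split => [z|]; last by exists (expR (l * C)).
  apply: measurableT_comp => //; apply: measurable_funM => //.
  apply: (@measurableT_comp _ _ _ _ (Eenv (fun n => (n <= M%:Z)%R)) _ (g^~ (after N z))).
    by have [] := observable_measurable (after N z) og.
  by apply: measurable_shift => k /= kM; rewrite /L; lia.
have h0 : nice (fun n => (0 <= n)%R) h.
  split => [z|]; last by exists (expR (l * C)).
  apply: measurableT_comp => //; apply: measurable_funM => //.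
  apply: (@measurableT_comp _ _ _ _ (Eenv (fun n => (- N%:Z <= n)%R)) _ (g^~ (after N z))).
    by have [] := observable_measurable (after N z) og.
  by apply: measurable_shift => k /= kM; lia.
have nmL : n = (m * L + n %% L)%N by rewrite -divn_eq.
have mn : m%:R <= n%:R / L%:R :> R.
  by rewrite ler_pdivlMr// -natrM ler_nat; exact: leq_divM.
apply: (@le_trans _ _ (TE (n + L) (fun w z => \sum_(r < L)
    expR (- (l * x)) * \prod_(i < m) seen h (r + i * L) w z))).
  apply: le_TE => //.
  - apply: tame_lt; apply: tame_sum => j; exact: tame_observable og.
  - apply: tame_sum => r; apply: tameM => //; exact: tame_path.
  move=> t z; case: ltP => [|_]; last first.
    apply: sumr_ge0 => r _; rewrite mulr_ge0 ?expR_ge0//.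
    by apply: prodr_ge0 => i _; exact: expR_ge0.
  set a := fun j => seen g j (om t) z.
  move=> big; have aC j : `|a j| <= C by exact: gC.
  have := lt_le_trans big (psum_le_residues N n aC (ltn0Sn _ : (0 < L)%N)).
  rewrite -/B -/m -ltrBlDr => big'.
  (* Pigeonhole: the L class sums total more than L x. *)
  have [r hr] : exists r : 'I_L, x < \sum_(i < m) a (N + (r + i * L))%N.
    apply: contrapT => hr; move: big'; apply/negP; rewrite -leNgt.
    apply: (@le_trans _ _ (\sum_(r < L) x)).
      by apply: ler_sum => r _; rewrite leNgt; apply/negP => xr; apply: hr; exists r.
    rewrite sumr_const card_ord -[x *+ _]mulr_natr.
    by rewrite -ler_pdivlMr.
  rewrite (bigD1 r)//= -[X in X <= _]addr0 lerD//; last first.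
    apply: sumr_ge0 => s _; rewrite mulr_ge0 ?expR_ge0//.
    by apply: prodr_ge0 => i _; exact: expR_ge0.
  have -> : \prod_(i < m) seen h (r + i * L) (om t) z =
      expR (l * \sum_(i < m) a (N + (r + i * L))%N).
    rewrite mulr_sumr expR_sum; apply: eq_bigr => i _.
    by rewrite {1}/seen /h seen_after /a addnC.
  rewrite -expRD -[X in X <= _]expR0 ler_expR.
  by rewrite -mulrN -mulrDr mulr_ge0 ?(ltW l0)//; lra.
rewrite TE_sum//; last by move=> r; apply: tameM => //; exact: tame_path.
apply: (@le_trans _ _ (\sum_(r < L) expR (- (l * x)) * expR (2 * (l * C) ^+ 2) ^+ m)).
  apply: ler_sum => r _; rewrite TE_Z// ler_wpM2l ?expR_ge0//.
  (* The L extra steps of the horizon make room for the delay r < L. *)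
  have -> : (n + L = r + (m * L + (n %% L + (L - r))))%N.
    by rewrite {1}nmL; have := ltn_ord r; lia.
  rewrite TE_renewal_delayed// lerXn2r ?nnegrE ?expR_ge0//; last exact: mgf_le (ltW l0) lC.
  by apply: TE_ge0 => //= t z; exact: expR_ge0.
rewrite sumr_const card_ord -[X in X <= _]mulr_natl -mulrA ler_wpM2l// -expRM_natl -!expRD ler_expR.
have e1 : m%:R * (2 * (l * C) ^+ 2) <= n%:R / L%:R * (l * eps / 2).
  apply: ler_pM => //; first by rewrite mulr_ge0// sqr_ge0.
  have -> : 2 * (l * C) ^+ 2 = l * (l * (4 * C ^+ 2)) / 2 by field.
  by rewrite ler_pM2r ?invr_gt0// ler_pM2l.
have -> : l * B / L%:R - l * eps / (2 * L%:R) * n%:R =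
    - (l * x) + n%:R / L%:R * (l * eps / 2).
  by rewrite /x; field; rewrite gt_eqF.
by rewrite lerD2l.
Qed.

End Chernoff.

(** * Two-sided deviation of the empirical average *)

Section Deviation.
Set Implicit Arguments.
Unset Strict Implicit.
Notation shift := Defs.shift.
Variables (R : realType) (d : nat) (u0 : U d).
Notation Eenv Pt := (g_sigma_algebraType (@coord_sys R d Pt)).

Variables (dT : measure_display) (T : measurableType dT) (P : probability T R).
Variable pi : int -> site d -> U d -> T -> R.
Hypothesis Hmeas : forall n x u, measurable_fun setT (pi n x u).
Hypothesis Hprob : forall n x t,
  (forall u, 0 <= pi n x u t) /\ \sum_(z : U d) pi n x z t = 1.
Hypothesis Hiid : iid_field P pi.
Variable theta : 'I_d -> R.

Notation om := (omega pi).
Notation TE := (TE u0 P pi theta).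
Notation AE := (AE u0 P pi).
Notation Lam := (Lambda_c P pi theta).

Lemma E00E L G : tame pi G -> E00 P pi u0 L G = AE L G.
Proof.
move=> tG; rewrite /E00 /AE.
under eq_bigr do rewrite -(EFin_Ex P (bmeas_weightM Hmeas Hprob _ _ tG)).
by rewrite sumEFin.
Qed.

Lemma P00E L (A : Env R d -> (nat -> U d) -> Prop) (b : Env R d -> (nat -> U d) -> bool) :
  (forall w z, A w z <-> b w z) -> tame pi (fun w z => (b w z)%:R) ->
  P00 P pi u0 L A = AE L (fun w z => (b w z)%:R).
Proof.
move=> Ab tb; rewrite -E00E// /P00 /E00; congr fine; apply: eq_bigr => s _.
rewrite integral_mkcond; apply: eq_integral => t _; rewrite patchE.
case: ifPn => [/set_mem /= At|/negP nAt].
  by rewrite (Ab _ _).1 ?mulr1.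
have /negbTE -> : ~~ b (om t) (ext u0 s) by apply/negP => bt; apply/nAt/mem_set/Ab.
by rewrite mulr0.
Qed.

Lemma mu_intE N M K (f : Env R d -> (nat -> U d) -> R) : tame pi (seen f N) ->
  mu_int P pi u0 theta N M K f = TE (N + M + K).+1 (seen f N).
Proof.
move=> tf; rewrite /mu_int E00E.
  by apply: eq_AE => t z; rewrite tiltE.
exact: (tameM (tame_path pi (fun z => expR _)) tf).
Qed.

Lemma nu_intE (f : Env R d -> (nat -> U d) -> R) n w z :
  nu_int f n w z = n%:R^-1 * \sum_(j < n) seen f j w z.
Proof. by []. Qed.

Lemma nu_int_agree (K n : nat) (f : Env R d -> (nat -> U d) -> R) :
  (forall w z z', agree K z z' -> f w z = f w z') ->
  forall w z z', agree (n + K) z z' -> nu_int f n w z = nu_int f n w z'.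
Proof.
move=> fK w z z' zz'; rewrite !nu_intE; congr (_ * _); apply: eq_bigr => j _.
have zz'j : agree (j + K) z z'.
  by apply: agree_le zz'; rewrite leq_add2r ltnW.
rewrite /seen (pos_agree (agree_le (leq_addr _ _) zz'j)).
by apply: fK; exact: agree_after zz'j.
Qed.

Lemma meas_wrt_comp (S : set_system (Env R d)) (h : Env R d -> R) (phi : R -> R) :
  measurable_fun setT phi -> meas_wrt S h -> meas_wrt S (phi \o h).
Proof.
move=> mphi mh B mB; apply: (mh (phi @^-1` B)).
by rewrite -[X in measurable X]setTI; exact: mphi.
Qed.

Lemma observable_affine N M K C (f : Env R d -> (nat -> U d) -> R) (a b : R) :
  observable N M K C f ->
  observable N M K (`|a| + `|b| * C) (fun w z => a + b * f w z).
Proof.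
move=> [fC fK fm]; split.
- move=> w z; rewrite (le_trans (ler_normD _ _))// lerD2l normrM ler_wpM2l//.
- by move=> w z z' /fK fE; rewrite (fE w).
- move=> z; have [m1 m2] := fm z.
  have mphi : measurable_fun setT (fun x : R => a + b * x).
    by apply: measurable_funD => //; exact: measurable_funM.
  by split; [exact: (meas_wrt_comp mphi m1)|exact: (meas_wrt_comp mphi m2)].
Qed.

(** [upper_deviation] is applied to f - mu and mu - f, both centred because mu is the tilted
    expectation of [f] seen from time N. *)
Lemma deviation N M K C f (eps : R) : observable N M K C f -> 0 < eps ->
  exists c A : R, [/\ 0 < c, 0 <= A &
    forall n, (0 < n)%N ->
    TE (n + (N + M + K).+1) (fun w z => (eps <
      `|nu_int f n w z - mu_int P pi u0 theta N M K f|)%R%:R) <=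
      A * expR (- (c * n%:R))].
Proof.
move=> of_ eps0; set mu := mu_int _ _ _ _ _ _ _ _.
have tf j : tame pi (seen f j) by exact: tame_observable of_.
have muE : mu = TE (N + M + K).+1 (seen f N) by exact: mu_intE.
have tc c : tame pi (fun _ _ => c) by exact: tame_path.
have C0 : 0 <= C.
  by have [fC _ _] := of_; exact: le_trans (normr_ge0 _) (fC (fun _ _ _ => 0) (fun=> u0)).
(* Bounds both centred functions; the 1 makes it positive even if [f] vanishes. *)
pose D := `|mu| + C + 1.
have D0 : 0 < D by rewrite ltr_wpDl// addr_ge0.
have [c [A [c0 A0 H]]] := upper_deviation u0 Hmeas Hprob Hiid theta N M K D0 eps0.
have gP (s : R) : `|s| = 1 -> observable N M K D (fun w z => - (s * mu) + s * f w z) /\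
    TE (N + M + K).+1 (seen (fun w z => - (s * mu) + s * f w z) N) = 0.
  move=> s1; split.
    have [gC gK gm] := observable_affine (- (s * mu)) s of_; split => // w z.
    rewrite (le_trans (gC w z))// s1 normrN normrM s1 !mul1r /D.
    by rewrite lerDl.
  transitivity (TE (N + M + K).+1 (fun w z => - (s * mu) + s * seen f N w z)) => //.
  rewrite TE_D//; last exact: tameM.
  by rewrite TE_cst// TE_Z// -muE addNr.
exists c, (2 * A); split => //; first by rewrite mulr_ge0.
move=> n n0.
have [ob1 z1] := gP 1 (normr1 _).
have [ob2 z2] := gP (-1) (normrN1 _).
have h1 := H _ ob1 z1 n; have h2 := H _ ob2 z2 n.
have n0' : (0 : R) < n%:R by rewrite ltr0n.
have t1 : tame pi (fun w z => (n%:R * eps <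
    \sum_(j < n) seen (fun w z => - (1 * mu) + 1 * f w z) j w z)%R%:R).
  by apply: tame_lt; apply: tame_sum => j; exact: tame_observable ob1.
have t2 : tame pi (fun w z => (n%:R * eps <
    \sum_(j < n) seen (fun w z => - (-1 * mu) + -1 * f w z) j w z)%R%:R).
  by apply: tame_lt; apply: tame_sum => j; exact: tame_observable ob2.
have -> : 2 * A * expR (- (c * n%:R)) = A * expR (- (c * n%:R)) + A * expR (- (c * n%:R)).
  by ring.
apply: le_trans (lerD h1 h2); rewrite -TE_D//; apply: le_TE => //.
- move=> z; apply: bmeas_bool; apply: measurable_fun_ltr => //.
  apply: measurableT_comp => //; apply: measurable_funB => //.
  apply: measurable_funM => //; apply: measurable_sum => j.
  by have [] := tf j z.
- exact: tameD.
move=> t z; case: ltP => [|_]; last by rewrite addr_ge0.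
rewrite nu_intE => dev.
have sE (s : R) : \sum_(j < n) seen (fun w z => - (s * mu) + s * f w z) j (om t) z =
    s * (\sum_(j < n) seen f j (om t) z - n%:R * mu).
  rewrite big_split /= sumr_const card_ord -mulr_sumr mulNrn -mulr_natl.
  by ring.
rewrite !sE; move: dev.
set S := \sum_(j < n) _ => dev.
have : n%:R * eps < `|S - n%:R * mu|.
  rewrite -[n%:R in X in X < _](ger0_norm (ltW n0')).
  move: dev; rewrite -(ltr_pM2l n0') => /lt_le_trans; rewrite (ger0_norm (ltW n0')); apply.
  rewrite -[X in X * `| _ |](ger0_norm (ltW n0')) -normrM mulrBr mulrA divff ?mul1r//.
  by rewrite gt_eqF.
rewrite mul1r mulN1r; case: (lerP 0 (S - n%:R * mu)) => h.
  by rewrite (ger0_norm h) => ->; rewrite lerDl.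
by rewrite (ltr0_norm h) => ->; rewrite lerDr.
Qed.

End Deviation.

(** * Conditioning on the velocity *)

Section RealFacts.
Set Implicit Arguments.
Unset Strict Implicit.
Variable R : realType.

Lemma is_derive_cexp (c a b : R) :
  is_derive (0 : R) 1 (fun h : R => c * expR (a + h * b)) (c * expR a * b).
Proof.
have h1 : is_derive (0 : R) 1 (fun h : R => a + h * b) b.
  apply: is_derive_eq.
  by rewrite add0r mul1r scale0r add0r /GRing.scale /= mulr1.
have h2 : is_derive (0 : R) 1 (expR \o (fun h : R => a + h * b)) (expR a * b).
  by apply: is_derive1_comp; rewrite mul0r addr0; exact: is_derive_expR.
by rewrite -mulrA; exact: (is_deriveZ c h2).
Qed.

Lemma is_derive_sum_cexp (I : Type) (s : seq I) (c a b : I -> R) :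
  is_derive (0 : R) 1 (fun h : R => \sum_(i <- s) c i * expR (a i + h * b i))
    (\sum_(i <- s) c i * expR (a i) * b i).
Proof.
elim: s => [|i s IH].
  rewrite big_nil; under eq_fun do rewrite big_nil.
  exact: is_derive_cst.
rewrite big_cons; under eq_fun do rewrite big_cons.
exact: (is_deriveD (is_derive_cexp (c i) (a i) (b i)) IH).
Qed.

Lemma expR_decay (c A eta : R) : 0 < c -> 0 < eta ->
  exists n0, forall n, (n0 <= n)%N -> A * expR (- (c * n%:R)) <= eta.
Proof.
move=> c0 eta0; exists (Num.bound `|A / (eta * c)|) => n hn.
rewrite expRN ler_pdivrMr ?expR_gt0//.
apply: (@le_trans _ _ (eta * (c * n%:R))); last first.
  rewrite ler_pM2l//; apply: le_trans (expR_ge1Dx _).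
  by rewrite lerDr.
rewrite mulrA [X in _ <= X]mulrC -ler_pdivrMr ?mulr_gt0//.
apply: le_trans (ler_norm _) _.
have h := @archi_boundP R `|A / (eta * c)| (normr_ge0 _).
apply: le_trans (ltW h) _.
by rewrite ler_nat.
Qed.

Lemma vecU_norm (d : nat) (u : U d) i : `|(vecU u i)%:~R : R| <= 1.
Proof.
by rewrite /vecU; case: ifP => _; [case: ifP => _|]; rewrite ?normr0 ?normrN1 ?normr1.
Qed.

(** An upper limit along a filter is an infimum of suprema over its members, so one member suffices.
    This serves for both the limit in delta and the limit in n. *)
Lemma limf_esup_le (T : choiceType) (X : filteredType T) (f : X -> \bar R)
    (F : set_system X) (V : set X) (l : \bar R) :
  F V -> (forall x, V x -> (f x <= l)%E) -> (limf_esup f F <= l)%E.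
Proof.
move=> FV Vl; apply: (@le_trans _ _ (ereal_sup (f @` V))).
  by apply: ereal_inf_lbound; exists V.
by apply: ge_ereal_sup => _ [x Vx <-]; exact: Vl.
Qed.

End RealFacts.

Section ConditionedWalk.
Set Implicit Arguments.
Unset Strict Implicit.
Notation shift := Defs.shift.
Variables (R : realType) (d : nat) (u0 : U d).
Notation Eenv Pt := (g_sigma_algebraType (@coord_sys R d Pt)).

Variables (dT : measure_display) (T : measurableType dT) (P : probability T R).
Variable pi : int -> site d -> U d -> T -> R.
Hypothesis Hmeas : forall n x u, measurable_fun setT (pi n x u).
Hypothesis Hprob : forall n x t,
  (forall u, 0 <= pi n x u t) /\ \sum_(z : U d) pi n x z t = 1.
Hypothesis Hiid : iid_field P pi.
Variables (theta xi : 'I_d -> R).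
Hypothesis Htheta : grad_Lambda_c_eq P pi theta xi.

Notation om := (omega pi).
Notation TE := (TE u0 P pi theta).
Notation AE := (AE u0 P pi).
Notation Lam := (Lambda_c P pi theta).

(** The chain rule computes the partial derivative of Lambda_c as the mean of the tilted step law,
    and [Htheta] gives its value; this is where theta is tied to xi. *)
Lemma tilted_mean i :
  \sum_(u : U d) q P pi u * expR (dotU theta u - Lam) * (vecU u i)%:~R = xi i.
Proof.
set F := fun h : R => \sum_(u : U d) q P pi u * expR (dotU theta u + h * (vecU u i)%:~R).
have FE : (fun h : R => Lambda_c P pi (fun j => theta j + (if j == i then h else 0))) = @ln R \o F.
  apply/funext => h; rewrite /Lambda_c /F /=; congr ln; apply: eq_bigr => u _.
  congr (_ * expR _); rewrite /dotU.
  under eq_bigr do rewrite mulrDl.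
  rewrite big_split /=; congr (_ + _).
  rewrite (bigD1 i)//= eqxx big1 ?addr0// => j /negbTE ->.
  by rewrite mul0r.
have F0 : F 0 = expR Lam.
  rewrite (expR_Lambda _ Hmeas Hprob) /F; apply: eq_bigr => u _.
  by rewrite mul0r addr0.
have h1 : is_derive (0 : R) 1 (@ln R \o F) ((F 0)^-1 *
    \sum_(u : U d) q P pi u * expR (dotU theta u) * (vecU u i)%:~R).
  apply: is_derive1_comp; first by apply: is_derive1_ln; rewrite F0 expR_gt0.
  exact: is_derive_sum_cexp.
have h2 := Htheta i; rewrite FE in h2.
rewrite -(@derive_val _ _ _ _ _ _ _ h2) (@derive_val _ _ _ _ _ _ _ h1) F0.
rewrite mulr_sumr; apply: eq_bigr => u _.
by rewrite expRD expRN; ring.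
Qed.

Definition near_velocity (delta : R) n (z : nat -> U d) : bool :=
  (euclid (fun i => (pos z n i)%:~R / n%:R - xi i) <= delta)%R.

Lemma near_velocity_agree delta n z z' : agree n z z' ->
  near_velocity delta n z = near_velocity delta n z'.
Proof. by move=> /pos_agree zz'; rewrite /near_velocity zz'. Qed.

Lemma euclid_ge_coord (v : 'I_d -> R) i : `|v i| <= euclid v.
Proof.
rewrite -sqrtr_sqr ler_wsqrtr// (bigD1 i)//= lerDl.
by apply: sumr_ge0 => j _; exact: sqr_ge0.
Qed.

Lemma euclid_le_sum (v : 'I_d -> R) : euclid v <= \sum_i `|v i|.
Proof.
have s0 : 0 <= \sum_i `|v i| by exact: sumr_ge0.
rewrite -[X in _ <= X](ger0_norm s0) -sqrtr_sqr ler_wsqrtr//.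
rewrite [X in _ <= X]expr2 mulr_suml; apply: ler_sum => i _.
rewrite -[X in X <= _]real_normK ?num_real// expr2 ler_wpM2l//.
by rewrite (bigD1 i)//= lerDl; exact: sumr_ge0.
Qed.

(** Mass 1/2 is enough: it costs a factor 2 in the conditional probability, invisible at exponential
    scale. *)
Lemma law_of_large_numbers delta : 0 < delta ->
  exists n0, forall n, (n0 <= n)%N ->
    1 / 2 <= TE n (fun _ z => (near_velocity delta n z)%:R).
Proof.
move=> delta0.
(* [u0] witnesses that there is a coordinate. *)
have d0 : (0 < d)%N by case: (d) u0 => // -[[]].
have dR : (0 : R) < d%:R by rewrite ltr0n.
(* If all coordinates are within [e], the l1 norm, hence the Euclidean one, is at most delta. *)
pose e : R := delta / d%:R.
have e0 : 0 < e by rewrite divr_gt0.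
pose f (i : 'I_d) : Env R d -> (nat -> U d) -> R := fun _ z => (vecU (z 0%N) i)%:~R.
have of_ i : observable 0 0 1 1 (f i).
  split => [w z|w z z' zz'|z]; first exact: vecU_norm.
    by rewrite /f zz'.
  split=> B mB.
    have := @measurable_cst _ _ (g_sigma_algebraType (@coord_sys R d (fun m => (- 0%:Z <= m)%R)))
      R setT (f i (fun _ _ _ => 0) z) measurableT B mB.
    by rewrite setTI.
  have := @measurable_cst _ _ (g_sigma_algebraType (@coord_sys R d (fun m => (m <= 0%:Z)%R)))
    R setT (f i (fun _ _ _ => 0) z) measurableT B mB.
  by rewrite setTI.
have muE i : mu_int P pi u0 theta 0 0 1 (f i) = xi i.
  rewrite (mu_intE u0 P Hmeas Hprob); last exact: (tame_observable Hmeas 0 (of_ i)).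
  rewrite -tilted_mean -(TE_step u0 P Hmeas Hprob theta (fun u => (vecU u i)%:~R)).
  (* With N = M = 0 and K = 1 the horizon of [mu_int] is 2, while the mean is a one-step
     expectation. *)
  rewrite -(TE_extend u0 Hmeas Hprob Hiid theta (a := 1) 1 (C := 1)
    (G := fun z => (vecU (z 0%N) i)%:~R))// => [z|z z' zz']; first exact: vecU_norm.
  by rewrite zz'.
have nuE i n w z : nu_int (f i) n w z = (pos z n i)%:~R / n%:R.
  rewrite /nu_int mulrC; congr (_ / _); rewrite /pos rmorph_sum; apply: eq_bigr => j _.
  by rewrite /f addn0.
(* [deviation] applied to the coordinates of the first step, whose tilted mean is xi *)
have far i : exists n1, forall n, (n1 <= n)%N ->
    TE n (fun _ z => (e < `|(pos z n i)%:~R / n%:R - xi i|)%R%:R) <= 1 / (2 * d%:R).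
  have [c [A [c0 A0 H]]] := deviation u0 Hmeas Hprob Hiid theta (of_ i) e0.
  have eta0 : (0 : R) < 1 / (2 * d%:R) by rewrite divr_gt0// mulr_gt0.
  have [n1 Hn1] := expR_decay A c0 eta0.
  (* The successor ensures n > 0, required by [deviation]. *)
  exists n1.+1 => n hn; apply: le_trans (Hn1 n (ltnW hn)).
  apply: le_trans (H n (leq_trans _ hn)) => //.
  rewrite muE -(TE_extend u0 Hmeas Hprob Hiid theta (a := n) (0 + 0 + 1).+1 (C := 1)
    (G := fun z => (e < `|(pos z n i)%:~R / n%:R - xi i|)%R%:R)).
  - by rewrite le_eqVlt; apply/orP; left; apply/eqP; apply: eq_TE => t z; rewrite nuE.
  - by move=> z; case: (_ < _); rewrite ?normr0 ?normr1.
  - by move=> z z' /pos_agree ->.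
have [n1 Hn1] := choice far.
exists (\max_(i < d) n1 i) => n hn.
have tp (G : (nat -> U d) -> R) : tame pi (fun _ z => G z) by exact: tame_path.
have : TE n (fun _ _ => 1) <= TE n (fun _ z => (near_velocity delta n z)%:R +
    \sum_(i < d) (e < `|(pos z n i)%:~R / n%:R - xi i|)%R%:R).
  apply: le_TE => //.
  move=> t z; rewrite /near_velocity.
  have [|] := boolP (_ <= delta) => h; first by rewrite lerDl sumr_ge0.
  have [i hi] : exists i : 'I_d, e < `|(pos z n i)%:~R / n%:R - xi i|.
    apply: contrapT => hi; move/negP: h; apply; apply: le_trans (euclid_le_sum _) _.
    apply: (@le_trans _ _ (\sum_(i < d) e)); last first.
      by rewrite sumr_const card_ord -mulr_natr /e divfK// gt_eqF.
    by apply: ler_sum => i _; rewrite leNgt; apply/negP => ?; apply: hi; exists i.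
  by rewrite add0r (bigD1 i)//= hi lerDl sumr_ge0.
rewrite TE_cst// TE_D// TE_sum// => h.
have : \sum_(i < d) TE n (fun _ z => (e < `|(pos z n i)%:~R / n%:R - xi i|)%R%:R) <= 1 / 2.
  apply: (@le_trans _ _ (\sum_(i < d) 1 / (2 * d%:R))).
    by apply: ler_sum => i _; apply: Hn1; apply: leq_trans hn; exact: leq_bigmax.
  rewrite sumr_const card_ord -mulr_natr.
  by rewrite le_eqVlt; apply/orP; left; apply/eqP; field; rewrite gt_eqF.
by move: h; lra.
Qed.

End ConditionedWalk.

(** * Undoing the tilt near the velocity xi *)

Section TiltBounds.
Set Implicit Arguments.
Unset Strict Implicit.
Variables (R : realType) (d : nat) (u0 : U d).

Variables (dT : measure_display) (T : measurableType dT) (P : probability T R).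
Variable pi : int -> site d -> U d -> T -> R.
Hypothesis Hmeas : forall n x u, measurable_fun setT (pi n x u).
Hypothesis Hprob : forall n x t,
  (forall u, 0 <= pi n x u t) /\ \sum_(z : U d) pi n x z t = 1.
Hypothesis Hiid : iid_field P pi.
Variables (theta xi : 'I_d -> R).

Notation TE := (TE u0 P pi theta).
Notation AE := (AE u0 P pi).
Notation Lam := (Lambda_c P pi theta).

Let th := \sum_i theta i * xi i.
Let nt := \sum_i `|theta i|.

(** <theta, X_n> equals n<theta, xi> up to n times <theta, X_n/n - xi>, whose size is at most
    |theta|_1 delta since every coordinate is bounded by the Euclidean norm. *)
Lemma tilt_near_velocity delta n z : (0 < n)%N -> near_velocity xi delta n z ->
  expR (n%:R * (th - Lam - nt * delta)) <= tilt P pi theta z n <=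
  expR (n%:R * (th - Lam + nt * delta)).
Proof.
move=> n0 hz; rewrite tiltE !ler_expR.
have n0' : (n%:R : R) != 0 by rewrite pnatr_eq0 -lt0n.
set v := fun i => (pos z n i)%:~R / n%:R - xi i.
have -> : \sum_i theta i * (pos z n i)%:~R = n%:R * (th + \sum_i theta i * v i).
  rewrite /th -big_split /= mulr_sumr; apply: eq_bigr => i _.
  by rewrite /v; field.
have : `|\sum_i theta i * v i| <= nt * delta.
  apply: le_trans (ler_norm_sum _ _ _) _; rewrite /nt mulr_suml; apply: ler_sum => i _.
  by rewrite normrM ler_wpM2l// (le_trans (euclid_ge_coord _ _) hz).
rewrite ler_norml => /andP[h1 h2].
have nn : (0 : R) <= n%:R by [].
by rewrite -mulrBr !ler_wpM2l//; lra.
Qed.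

(** The L steps after time n are not controlled by the velocity; a crude bound per step suffices, as
    L does not grow with n. *)
Let kappa L : R := expR (- (nt + `|Lam|)) ^+ L.

Lemma tilt_lower L z : kappa L <= tilt P pi theta z L.
Proof.
rewrite /kappa -[L in _ ^+ L]card_ord -prodr_const; apply: ler_prod => j _.
rewrite expR_ge0 /= ler_expR opprD lerD//; last first.
  by rewrite lerN2 ler_norm.
rewrite lerNl; apply: le_trans (ler_norm _) _; rewrite normrN.
apply: le_trans (ler_norm_sum _ _ _) _; apply: ler_sum => i _.
by rewrite normrM -[X in _ <= X]mulr1 ler_wpM2l// vecU_norm.
Qed.

(** The velocity constraint serves only to bound the density from below and is then dropped. *)
Lemma AE_near_velocity_le delta n L (b : Env R d -> (nat -> U d) -> bool) : (0 < n)%N ->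
  tame pi (fun w z => (b w z)%:R) ->
  AE (n + L) (fun w z => (b w z && near_velocity xi delta n z)%:R) <=
  (expR (n%:R * (th - Lam - nt * delta)) * kappa L)^-1 * TE (n + L) (fun w z => (b w z)%:R).
Proof.
move=> n0 tb; set E := expR _.
have E0 : 0 < E * kappa L by rewrite mulr_gt0 ?exprn_gt0 ?expR_gt0.
have tbn : tame pi (fun w z => (b w z && near_velocity xi delta n z)%:R : R).
  move=> z; have := bmeasM (tb z) (@bmeas_cst R _ T (near_velocity xi delta n z)%:R).
  by congr bmeas; apply/funext => t; rewrite -natrM mulnb.
rewrite mulrC ler_pdivlMr// mulrC -(AE_Z _ _ Hmeas)//.
apply: le_AE => //.
- by apply: tameM => //; exact: (tame_path pi (fun=> E * kappa L)).
- exact: tame_tilt.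
move=> t z; case: (b _ _); rewrite /= ?mulr0 ?mulr1//.
have [h|_] := boolP (near_velocity _ _ _ _); last by rewrite mulr0 tilt_ge0.
rewrite mulr1 tilt_after ler_pM ?expR_ge0 ?tilt_lower ?exprn_ge0 ?expR_ge0//.
by have /andP[] := tilt_near_velocity n0 h.
Qed.

Lemma TE_near_velocity_le delta n : (0 < n)%N ->
  TE n (fun _ z => (near_velocity xi delta n z)%:R) <=
  expR (n%:R * (th - Lam + nt * delta)) *
  AE n (fun _ z => (near_velocity xi delta n z)%:R).
Proof.
move=> n0; have tp (G : (nat -> U d) -> R) : tame pi (fun _ z => G z) by exact: tame_path.
rewrite -(AE_Z _ _ Hmeas)//; apply: le_AE => // t z.
have [h|_] := boolP (near_velocity _ _ _ _); last by rewrite !mulr0.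
by rewrite !mulr1; have /andP[] := tilt_near_velocity n0 h.
Qed.

(** The terms <theta, xi> - Lambda_c cancel between numerator and denominator, leaving 2 |theta|_1
    delta against c. [hD] also forces [Den] to be positive, so the conditioning is not
    degenerate. *)
Lemma ratio_bound delta n L p Num Den A c : (0 < n)%N ->
  p = Num / Den -> 0 <= A ->
  Num <= (expR (n%:R * (th - Lam - nt * delta)) * kappa L)^-1 * (A * expR (- (c * n%:R))) ->
  1 / 2 <= expR (n%:R * (th - Lam + nt * delta)) * Den ->
  p <= (2 * A / kappa L) * expR (n%:R * (2 * nt * delta - c)).
Proof.
move=> n0 -> A0 hN hD; set E1 := expR _ in hN; set E2 := expR _ in hD.
have k0 : 0 < kappa L by rewrite exprn_gt0 ?expR_gt0.
have D0 : 0 < Den.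
  by rewrite -(pmulr_rgt0 _ (expR_gt0 (n%:R * (th - Lam + nt * delta)))) (lt_le_trans _ hD).
rewrite ler_pdivrMr//; apply: le_trans hN _.
have -> : n%:R * (2 * nt * delta - c) = n%:R * (th - Lam + nt * delta) +
  (- (n%:R * (th - Lam - nt * delta)) - c * n%:R) by ring.
rewrite !expRD expRN -/E1 -/E2.
have -> : (E1 * kappa L)^-1 * (A * expR (- (c * n%:R))) =
   (A / kappa L * (E1^-1 * expR (- (c * n%:R)))) * 1.
  by field; rewrite !gt_eqF// expR_gt0.
have -> : 2 * A / kappa L * (E2 * (E1^-1 * expR (- (c * n%:R)))) * Den =
  (A / kappa L * (E1^-1 * expR (- (c * n%:R)))) * (2 * (E2 * Den)) by ring.
rewrite ler_wpM2l//; last by lra.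
by rewrite !mulr_ge0 ?invr_ge0 ?expR_ge0// ltW.
Qed.

End TiltBounds.

(** * Extraction of the exponential rate *)

Section ElogBound.
Variable R : realType.

(** Half of the rate is spent on absorbing ln B; a nonpositive [p] has [elog] equal to -oo. *)
Lemma elog_decay (p B c : R) n : (0 < n)%N -> 1 <= B -> 0 < c ->
  p <= B * expR (- (c * n%:R)) -> ln B <= c / 2 * n%:R ->
  ((n%:R^-1)%:E * elog p <= (- (c / 2))%:E)%E.
Proof.
move=> n0 B1 c0 hp hn; have n0' : (0 : R) < n%:R by rewrite ltr0n.
rewrite /elog; case: ifPn => p0; last first.
  by rewrite gt0_muleNy ?leNye// lte_fin invr_gt0.
have B0 : 0 < B by exact: lt_le_trans B1.
rewrite -EFinM lee_fin mulrC ler_pdivrMr//.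
have : ln p <= ln B - c * n%:R.
  rewrite -[- (c * _)]expRK -lnM ?posrE ?expR_gt0// ler_ln ?posrE//.
  by rewrite mulr_gt0// expR_gt0.
by lra.
Qed.

End ElogBound.

Theorem theorem1p18
  (R : realType) (d : nat) (hd : (0 < d)%N)
  (dT : measure_display) (T : measurableType dT) (P : probability T R)
  (pi : int -> site d -> U d -> T -> R)
  (Hmeas : forall n x z, measurable_fun setT (pi n x z))
  (Hprob : forall n x t,
     (forall z, 0 <= pi n x z t) /\ \sum_(z : U d) pi n x z t = 1)
  (Hiid : iid_field P pi)
  (Hell : exists c1 : R, 0 < c1 /\
     forall z : U d, P [set t | c1 <= pi 0 (@site0 d) z t] = 1%E)
  (xi : 'I_d -> R) (Hxi : \sum_i `|xi i| < 1)
  (theta : 'I_d -> R) (Htheta : grad_Lambda_c_eq P pi theta xi)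
  (N M K : nat) (f : Env R d -> (nat -> U d) -> R)
  (Hbdd : exists C : R, forall w z, `|f w z| <= C)
  (HK : forall w z z', (forall k, (k < K)%N -> z k = z' k) -> f w z = f w z')
  (Hmf : forall z, meas_wrt (@Bplus R d (- (N%:Z))) (f^~ z) /\
                   meas_wrt (@Bminus R d (M%:Z)) (f^~ z))
  (eps : R) (Heps : 0 < eps) :
  (limf_esup
     (fun delta : R =>
        limn_esup (fun n : nat =>
          ((n%:R)^-1)%R%:E *
          elog (P00cond P pi (u0 hd) (n + K)
                  (fun w z => (eps < `|nu_int f n w z - mu_int P pi (u0 hd) theta N M K f|)%R)
                  (fun w z => (euclid (fun i => (pos z n i)%:~R / n%:R - xi i) <= delta)%R))))
     (0 : R)^'+ < 0%E)%E.
Proof.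
have [C HC] := Hbdd.
have [c [A [c0 A0 Hdev]]] :=
  deviation (u0 hd) Hmeas Hprob Hiid theta (And3 HC HK Hmf) Heps.
set mu := mu_int _ _ _ _ _ _ _ _ in Hdev *.
pose L := (N + M + K).+1.
pose nt := \sum_i `|theta i|.
have nt0 : 0 <= nt by exact: sumr_ge0.
pose kap : R := expR (- (nt + `|Lambda_c P pi theta|)) ^+ L.
have kap0 : 0 < kap by rewrite exprn_gt0 ?expR_gt0.
(* The prefactor of [ratio_bound], raised above 1 so that its logarithm is nonnegative. *)
pose A2 : R := 2 * A / kap + 1.
have A21 : 1 <= A2 by rewrite lerDr divr_ge0 ?mulr_ge0// ltW.
pose c2 := c / 2.
have c20 : 0 < c2 by rewrite divr_gt0.
(* Chosen so that 2 |theta|_1 delta is at most c/2; the 1 avoids dividing by zero when theta = 0. *)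
pose delta0 : R := c2 / (2 * (nt + 1)).
have delta00 : 0 < delta0 by rewrite divr_gt0// mulr_gt0// ltr_wpDl.
apply: (@le_lt_trans _ _ (- (c2 / 2))%:E); last first.
  by rewrite lte_fin oppr_lt0 divr_gt0.
apply: (limf_esup_le (V := [set delta : R | 0 < delta <= delta0])).
  near=> delta; apply/andP; split; first by near: delta; exact: nbhs_right_gt.
  by near: delta; exact: nbhs_right_le.
move=> delta /= /andP[dpos dle].
have [n1 Hlln] := law_of_large_numbers (u0 hd) Hmeas Hprob Hiid Htheta dpos.
(* From here on the prefactor costs at most half of the remaining rate c/2. The threshold from the
   law of large numbers depends on delta, but the resulting rate c/4 does not. *)
pose n2 := Num.bound (ln A2 / (c2 / 2)).
apply: (limf_esup_le (V := [set n | (maxn 1 (maxn n1 n2) <= n)%N])).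
  by exists (maxn 1 (maxn n1 n2)).
move=> n /=; rewrite !geq_max => /and3P[npos n1n n2n].
have tp (G : (nat -> U d) -> R) : tame pi (fun _ z => G z) by exact: tame_path.
pose far w z : bool := (eps < `|nu_int f n w z - mu|)%R.
have tfar : tame pi (fun w z => (far w z)%:R : R).
  move=> z; apply: bmeas_bool; apply: measurable_fun_ltr => //.
  apply: measurableT_comp => //; apply: measurable_funB => //.
  apply: measurable_funM => //; apply: measurable_sum => j.
  by have [] := tame_observable Hmeas j (And3 HC HK Hmf) z.
have tnear : tame pi (fun _ z => (near_velocity xi delta n z)%:R : R) by exact: tp.
have tboth : tame pi (fun w z => (far w z && near_velocity xi delta n z)%:R : R).
  move=> z; have := bmeasM (tfar z) (tnear z).
  by congr bmeas; apply/funext => t; rewrite -natrM mulnb.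
(* Both probabilities are defined with n + K steps. The numerator is lengthened to n + L, the
   horizon of [deviation]; the denominator is shortened to n, all that the velocity needs. *)
have pE : P00cond P pi (u0 hd) (n + K)
    (fun w z => (eps < `|nu_int f n w z - mu|)%R)
    (fun w z => (euclid (fun i => (pos z n i)%:~R / n%:R - xi i) <= delta)%R) =
    AE (u0 hd) P pi (n + L) (fun w z => (far w z && near_velocity xi delta n z)%:R) /
    AE (u0 hd) P pi n (fun _ z => (near_velocity xi delta n z)%:R).
  rewrite /P00cond; congr (_ / _).
    rewrite (P00E (u0 hd) P Hmeas Hprob (n + K)
      (b := fun w z => far w z && near_velocity xi delta n z))//; last first.
      by move=> w z; split => [[a b]|/andP[]//]; apply/andP.
    have -> : (n + L = n + K + (N + M).+1)%N by rewrite -(addnA n K) (addnS K) (addnC K).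
    rewrite (AE_extend (u0 hd) P Hmeas Hprob (a := n + K))// => w z z' zz'.
    rewrite (near_velocity_agree _ _ (agree_le (leq_addr _ _) zz')).
    by rewrite /far (nu_int_agree HK _ zz').
  rewrite (P00E (u0 hd) P Hmeas Hprob (n + K) (b := fun _ z => near_velocity xi delta n z))//.
  rewrite (AE_extend (u0 hd) P Hmeas Hprob (a := n))// => w z z' zz'.
  by rewrite (near_velocity_agree _ _ zz').
have npR : (0 : R) < n%:R by rewrite ltr0n.
apply: (@elog_decay _ _ A2) => //.
  have hD := le_trans (Hlln n n1n)
    (TE_near_velocity_le (u0 hd) P Hmeas Hprob theta xi delta npos).
  apply: le_trans (ratio_bound (L := L) (c := c) npos pE A0 _ hD) _.
    apply: le_trans (AE_near_velocity_le (u0 hd) P Hmeas Hprob theta xi delta L npos tfar) _.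
    by rewrite ler_wpM2l ?Hdev// invr_ge0 mulr_ge0 ?expR_ge0// ltW.
  apply: ler_pM; rewrite ?expR_ge0// ?divr_ge0 ?mulr_ge0 ?(ltW kap0)//.
    by rewrite lerDl.
  rewrite ler_expR mulrC -mulNr ler_pM2r// -/nt.
  have : delta * (2 * (nt + 1)) <= c2 by rewrite -ler_pdivlMr// mulr_gt0// ltr_wpDl.
  by rewrite /c2; move: dpos; lra.
rewrite mulrC -ler_pdivrMr ?divr_gt0//.
have lnA : 0 <= ln A2 / (c2 / 2) by rewrite divr_ge0 ?ln_ge0// ltW// divr_gt0.
apply: le_trans (ltW (archi_boundP lnA)) _.
by rewrite ler_nat.
Unshelve. all: by end_near. Qed.
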